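(* Let $M_1=(N,\mathcal{I}_1),\dots,M_k=(N,\mathcal{I}_k)$ be $k$ matroids on a common finite ground set $N$. Suppose that for each $j=1,\dots,k$ there is an order-oblivious algorithm $\mathcal{A}_j$ for the Matroid Secretary Problem on $M_j$ that is $c_j$-OPT-competitive. Then there is an order-oblivious online algorithm for the Matroid Intersection Secretary Problem on $M_1\cap M_2\cap\dots\cap M_k$ (feasible sets $\mathcal{F}=\bigcap_{j=1}^k\mathcal{I}_j$) that is $\left(\frac{1}{4k^2}\prod_{j=1}^k c_j\right)$-competitive.
   Context: Order-oblivious secretary model: there are $n$ elements $N$ with unknown nonnegative weights $w$ and a down-closed family $\mathcal{F}\subseteq 2^N$ accessible by an independence oracle. An algorithm first chooses a number $m\le n$ (possibly at random) and receives a uniformly random sample $S$ of $m$ elements of $N$, learning their weights; sampled elements can never be selected. Then the remaining elements arrive one by one in an adversarial order (which may depend on the sample but not on the algorithm's random bits); on arrival an element reveals its weight and the algorithm must immediately and irrevocably decide whether to select it. The selected set must lie in $\mathcal{F}$. An algorithm working in this model is called order-oblivious. It is $c$-competitive if for every weight function and every adversarial order the expected weight of the selected set is at least $c\cdot w(\mathrm{OPT})$, where $\mathrm{OPT}$ is a maximum-weight set in $\mathcal{F}$. The Matroid Secretary Problem (MSP) is the case $\mathcal{F}=\mathcal{I}$ for a matroid $M=(N,\mathcal{I})$; the Matroid Intersection Secretary Problem (MISP) is the case where $\mathcal{F}$ is the intersection of the independent-set families of several matroids on $N$. Ties between equal weights are broken by a fixed consistent rule, so the optimum is unique, and $\mathrm{OPT}$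 is taken to contain no element of weight $0$. An order-oblivious MSP algorithm $\mathcal{A}$ on $M$ is $c$-OPT-competitive if for every weight function and every $e\in\mathrm{OPT}$ (the maximum-weight independent set of $M$), $\mathbb{E}_S\left[\min_\sigma \Pr_r[e\in\mathcal{A}(S,r,\sigma)]\right]\ge c$, where $\mathcal{A}(S,r,\sigma)$ is the set selected by $\mathcal{A}$ given sample $S$, random bits $r$, and arrival order $\sigma$ of $N\setminus S$ in the second phase, the order being allowed to depend on $S$ and $e$. *)

(* Defs.v *)
From mathcomp Require Import all_boot all_order all_algebra.
From mathcomp Require Import all_classical all_reals all_analysis.

Set Implicit Arguments.
Unset Strict Implicit.
Unset Printing Implicit Defensive.

Import Order.TTheory GRing.Theory Num.Theory.
Local Open Scope ring_scope.

Record matroid (N : finType) := Matroid {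
  indep : {set {set N}};
  indep0 : finset.set0 \in indep;
  indepS : forall I J : {set N}, I \subset J -> J \in indep -> I \in indep;
  indep_exchange : forall I J : {set N}, I \in indep -> J \in indep ->
    (#|I| < #|J|)%N -> exists2 x, x \in J :\: I & (x |: I)%SET \in indep
}.

Definition weight (R : realType) (N : finType) (w : N -> R) (I : {set N}) : R :=
  \sum_(e in I) w e.

(* The tie-breaking rule is a total order [tie] on the ground set, smaller
   elements being preferred. *)
Definition tie_order (N : finType) (tie : rel N) : Prop :=
  [/\ transitive tie, antisymmetric tie & total tie].

(* [O] wins over [I]: their [tie]-first difference lies in [O]. *)
Definition tie_wins (N : finType) (tie : rel N) (O I : {set N}) : bool :=
  [exists e in O :\: I, [forall f in I :\: O, tie e f]].

Definition max_weight (R : realType) (N : finType) (F : {set {set N}})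
    (w : N -> R) (O : {set N}) : bool :=
  [&& O \in F, [forall e in O, 0 < w e] &
      [forall I in F, weight w I <= weight w O]].

(* Comparing two maximum-weight sets by their [tie]-first difference amounts to
   adding to the weight of each element an infinitesimal that is negligible
   with respect to those of the [tie]-smaller elements.  In a matroid
   this gives the output of the greedy algorithm run by decreasing weight, equal
   weights being ordered by [tie].  [opt_unique] below shows that [is_opt] has
   exactly one solution, so that the default value in [opt] is never used for
   a down-closed family. *)
Definition is_opt (R : realType) (N : finType) (tie : rel N)
    (F : {set {set N}}) (w : N -> R) (O : {set N}) : bool :=
  max_weight F w O &&
  [forall I, max_weight F w I ==> (I != O) ==> tie_wins tie O I].

Definition opt (R : realType) (N : finType) (tie : rel N)
    (F : {set {set N}}) (w : N -> R) : {set N} :=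
  odflt finset.set0 [pick O | is_opt tie F w O].

(* Weights known to the algorithm once the elements of [A] are revealed. *)
Definition revealed (R : realType) (N : finType) (w : N -> R) (A : {set N}) :
    {ffun N -> option R} :=
  [ffun x => if x \in A then Some (w x) else None].

(* [decide S past e o r] is the decision taken on the arrival of [e], where [S]
   is the sample, [past] the sequence of previous arrivals, [o] the weights
   revealed so far (those of [S], [past] and [e]) and [r] the random bits.  Past
   decisions are functions of these data. *)
Definition decision_rule (R : realType) (N : finType) (T : Type) : Type :=
  {set N} -> seq N -> N -> {ffun N -> option R} -> T -> bool.

Definition selected (R : realType) (N : finType) (T : Type)
    (decide : decision_rule R N T) (w : N -> R) (S : {set N}) (sigma : seq N)
    (r : T) : {set N} :=
  [set e in sigma |
    let past := take (index e sigma) sigma in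
    decide S past e (revealed w (S :|: [set x in rcons past e])) r]%SET.

Definition arrival_order (N : finType) (S : {set N}) (sigma : seq N) : bool :=
  perm_eq sigma (enum (~: S)).

(* [size_law m] is the probability of sampling [m] elements.  The random bits
   of the second phase are drawn from an arbitrary probability space,
   independently of the sample; there is no loss of generality in not letting
   their law depend on the sample, since a rule may read a separate block of
   bits for each of the finitely many samples. *)
Record order_oblivious (R : realType) (N : finType) (F : {set {set N}}) :=
  OrderOblivious {
  size_law : nat -> R;
  size_law_ge0 : forall m, 0 <= size_law m;
  size_law_sum1 : \sum_(m < #|N|.+1) size_law m = 1;
  bits_display : measure_display;
  bits : measurableType bits_display;
  bits_law : probability bits R;
  decide : decision_rule R N bits;
  decide_measurable : forall S past e o,
    measurable [set r | decide S past e o r]%classic;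
  decide_feasible : forall (w : N -> R) (S : {set N}) (sigma : seq N) (r : bits),
    (forall e, 0 <= w e) -> arrival_order S sigma ->
    selected decide w S sigma r \in F
}.

Arguments decide {R N F} _.

Definition sample_law (R : realType) (N : finType) (F : {set {set N}})
    (A : order_oblivious R F) (S : {set N}) : R :=
  size_law A #|S| / 'C(#|N|, #|S|)%:R.

Definition competitive (R : realType) (N : finType) (tie : rel N)
    (F : {set {set N}}) (A : order_oblivious R F) (c : R) : Prop :=
  forall (w : N -> R) (sigma : {set N} -> seq N),
    (forall e, 0 <= w e) -> (forall S, arrival_order S (sigma S)) ->
  ((c * weight w (opt tie F w))%:E <=
     \sum_(S : {set N}) (sample_law A S)%:E *
       'E_(bits_law A)[fun r => weight w (selected (decide A) w S (sigma S) r)])%E.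

Definition opt_competitive (R : realType) (N : finType) (tie : rel N)
    (F : {set {set N}}) (A : order_oblivious R F) (c : R) : Prop :=
  forall (w : N -> R) (e : N),
    (forall x, 0 <= w x) -> e \in opt tie F w ->
  (c%:E <=
     \sum_(S : {set N}) (sample_law A S)%:E *
       \big[Order.min/+oo]_(sigma <- permutations (enum (~: S)))
         bits_law A [set r | e \in selected (decide A) w S sigma r]%classic)%E.

Lemma sum_exp2_lt (N : finType) (D : {set N}) (a : N -> nat) (m : nat) :
  {in D &, injective a} -> {in D, forall f, a f < m}%N ->
  (\sum_(f in D) 2 ^ a f < 2 ^ m)%N.
Proof.
elim: m D => [|m IHm] D inja ltam.
  rewrite big_pred0 // => f; apply/negbTE/negP => /ltam; by rewrite ltn0.
have [[e eD ae]|noe] := altP (@exists_inP _ (mem D) (fun e => a e == m)).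
  rewrite (big_setD1 e) //= (eqP ae) expnS mul2n -addnn ltn_add2l.
  apply: IHm => [x y /setD1P[_ xD] /setD1P[_ yD]|f /setD1P[fe fD]].
    exact: inja.
  have := ltam f fD; rewrite ltnS leq_eqVlt => /orP[/eqP af|//].
  by case/eqP: fe; apply: inja => //; rewrite af (eqP ae).
apply: leq_trans (IHm D inja _) _; last by rewrite leq_exp2l.
move=> f fD; have := ltam f fD; rewrite ltnS leq_eqVlt => /orP[af|//].
by case/negP: noe; apply/exists_inP; exists f.
Qed.

Lemma opt_unique (R : realType) (N : finType) (tie : rel N)
    (F : {set {set N}}) (w : N -> R) :
  tie_order tie -> finset.set0 \in F ->
  (forall I J : {set N}, I \subset J -> J \in F -> I \in F) ->
  (forall e, 0 <= w e) ->
  forall O, is_opt tie F w O = (O == opt tie F w).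
Proof.
move=> [tr asym tot] F0 FS w0.
have uniqO O O' : is_opt tie F w O -> is_opt tie F w O' -> O = O'.
  move=> /andP[mO /forallP/(_ O')] + /andP[mO' /forallP/(_ O)].
  rewrite mO mO' /= => h1 h2; apply/eqP; apply: contraT => neq.
  move: h1 h2; rewrite (eq_sym O') neq /= => /exists_inP[e eD /forall_inP he].
  move=> /exists_inP[f fD /forall_inP hf].
  have ef : e = f by apply: asym; rewrite he // hf.
  by move: eD fD; rewrite ef !inE => /andP[/negbTE->] _ /andP[].
suff exO : exists O, is_opt tie F w O.
  case: exO => O hO.
  have ho : is_opt tie F w (opt tie F w).
    by rewrite /opt; case: pickP => [//|/(_ O)]; rewrite hO.
  by move=> O'; apply/idP/eqP => [/uniqO/(_ ho)//|->].
have [I0 mI0] : exists O, max_weight F w O.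
  case: (arg_maxP (weight w) F0) => I IF maxI.
  exists [set e in I | 0 < w e]%SET; apply/and3P; split.
  - by apply: FS IF; apply/fintype.subsetP => e; rewrite inE => /andP[].
  - by apply/forall_inP => e; rewrite inE => /andP[].
  apply/forall_inP => J JF; apply: le_trans (maxI J JF) _.
  rewrite /weight (bigID (fun e => 0 < w e)) /= [X in _ + X]big1 ?addr0.
    rewrite le_eqVlt; apply/orP; left; apply/eqP.
    by apply: eq_bigl => e; rewrite inE.
  by move=> e /andP[_ we]; apply/eqP; rewrite eq_le w0 andbT leNgt.
pose a e := #|[set f | (f != e) && tie e f]%SET|.
have lta e f : f != e -> tie e f -> (a f < a e)%N.
  move=> fe ef; apply: proper_card; apply/fintype.properP; split.
    apply/fintype.subsetP => g; rewrite !inE => /andP[gf fg].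
    rewrite (tr _ _ _ ef fg) andbT; apply: contraNneq fe => ge.
    by apply/eqP/asym; rewrite ef -ge fg.
  by exists f; rewrite !inE ?fe ?ef // eqxx.
have inja : injective a.
  move=> e f aef; apply/eqP; apply: contraT => ef.
  by case/orP: (tot e f) => /lta; rewrite ?[f == e]eq_sym ef aef ltnn => /(_ isT).
case: (@arg_maxnP _ I0 (max_weight F w) (fun O : {set N} => \sum_(e in O) 2 ^ a e)%N mI0) => O mO maxO.
exists O; rewrite /is_opt mO /=; apply/forallP => I.
apply/implyP => mI; apply/implyP => IO; have := maxO I mI.
apply: contraTT => nwin; rewrite -ltnNge.
have [e0 e0D] : exists e, e \in (O :\: I) :|: (I :\: O).
  apply/finset.set0Pn; apply: contra IO => /eqP/finset.setP E; apply/eqP/finset.setP => x.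
  by have := E x; rewrite !inE; case: (x \in I); case: (x \in O).
case: (@arg_maxnP _ e0 (mem ((O :\: I) :|: (I :\: O))) a e0D) => e eD maxe.
have ltD f : f \in (O :\: I) :|: (I :\: O) -> f != e -> tie e f.
  move=> fD fe; case/orP: (tot e f) => // /lta; rewrite eq_sym fe => /(_ isT).
  by rewrite ltnNge (maxe f fD : (a f <= a e)%N).
have eIO : e \in I :\: O.
  case/finset.setUP: eD => // eOI; case/negP: nwin.
  apply/exists_inP; exists e => //; apply/forall_inP => f fIO.
  apply: ltD; first by rewrite inE fIO orbT.
  by apply: contraTneq eOI => <-; move: fIO; rewrite !inE => /andP[/negbTE->]; rewrite andbF.
rewrite (big_setID I) [X in (_ < X)%N](big_setID O) /= finset.setIC ltn_add2l.
apply: (@leq_trans (2 ^ a e)); last by rewrite (big_setD1 e) //= leq_addr.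
apply: sum_exp2_lt => [x y _ _|f fOI]; first exact: inja.
have fe : f != e.
  by apply: contraTneq eIO => <-; move: fOI; rewrite !inE => /andP[/negbTE->]; rewrite andbF.
by apply: lta => //; apply: ltD => //; rewrite inE fOI.
Qed.

(* Main.v *)
Require Import Defs.
From HB Require Import structures.
From mathcomp Require Import all_boot all_order perm all_algebra.
From mathcomp Require Import reals ring lra.

(** Draw a random subset [T], containing each element with probability
    [p = 1 - 1/(2k)], and for every matroid an independent sample [S_j]
    distributed as the sample of the given algorithm [A_j].  The weight of an
    element is reset to [0] unless it lies outside [T] and could be added, at
    its turn, to the greedy feasible subset of [T]; this can be decided on
    arrival, and each [A_j] is run on the resulting weights.  Since the samples
    are independent, an element that is optimal in every matroid for the reset
    weights is selected by all the [A_j] with probability at least the product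
    of the [c_j].

    It remains to see that such elements have expected weight at least
    [w(OPT)/(4k^2)].  Let [V] be the set of elements whose weight is kept.
    Whether an element is in [T] is independent of whether it could be added
    to the greedy set, and the greedy subset of [T] is a [1/k]-approximation,
    so [E w(V)] is at least [(1-p)/k * w(OPT)].  For each matroid, the elements
    of the greedy set that are spanned by heavier elements of [V] are
    independent, hence not more numerous than the elements of [V] that are not
    so spanned; as the odds of sampling are [p/(1-p)], the spanned elements of
    [V] have expected weight at most [(1-p) E w(V)].  Discarding them for all
    [k] matroids leaves half of [E w(V)].

    To realise all samples by a single uniform one, the algorithm samples the
    union [S] of [T] and the [S_j], whose law only depends on the cardinality,
    and then draws [T] and the [S_j] from their law conditioned on that union.
    The elements of [S] outside [S_j] are presented to [A_j] first. *)

Set Implicit Arguments.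
Unset Strict Implicit.
Unset Printing Implicit Defensive.

Import Order.TTheory GRing.Theory Num.Theory.
Local Open Scope ring_scope.

(** * Greedy sets in matroids and their intersections *)

Section Greedy.
Variable N : finType.
Implicit Types (F : {set {set N}}) (l : seq N) (lt : rel N).

Definition greedy F l : {set N} :=
  foldl (fun I x => if x |: I \in F then x |: I else I) set0 l.

Lemma greedy_rcons F l x :
  greedy F (rcons l x) =
  if x |: greedy F l \in F then x |: greedy F l else greedy F l.
Proof. by rewrite /greedy foldl_rcons. Qed.

Lemma greedy_in F l : set0 \in F -> greedy F l \in F.
Proof.
by move=> common_set0; elim/last_ind: l => // l x IH; rewrite greedy_rcons; case: ifP.
Qed.

Lemma greedy_sub F l x : x \in greedy F l -> x \in l.
Proof.
elim/last_ind: l => [|l y IH]; first by rewrite inE.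
rewrite greedy_rcons mem_rcons inE; case: ifP => _; last by move/IH ->; rewrite orbT.
by rewrite in_setU1 => /orP[->//|/IH->]; rewrite orbT.
Qed.

Lemma greedy_cat F l1 l2 : greedy F l1 \subset greedy F (l1 ++ l2).
Proof.
elim/last_ind: l2 => [|l2 y IH]; first by rewrite cats0.
rewrite -rcons_cat greedy_rcons; case: ifP => // _.
exact: subset_trans IH (subsetUr _ _).
Qed.

Lemma greedy_catl F l1 l2 x :
  x \notin l2 -> (x \in greedy F (l1 ++ l2)) = (x \in greedy F l1).
Proof.
elim/last_ind: l2 => [|l2 y IH]; first by rewrite cats0.
rewrite mem_rcons inE negb_or => /andP[xy /IH <-].
by rewrite -rcons_cat greedy_rcons; case: ifP => // _; rewrite in_setU1 (negbTE xy).
Qed.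

(** In a sorted list the elements before [e] form a prefix, so filtering by [lt x e] amounts to
    stopping the greedy algorithm at the turn of [e]. *)
Lemma pairwise_split lt l e : transitive lt -> pairwise lt l ->
  l = [seq x <- l | lt x e] ++ [seq x <- l | ~~ lt x e].
Proof.
move=> tr; elim: l => //= x l IH /andP[/allP xl pl].
case: ifP => /= xe; first by rewrite -IH.
suff -> : [seq x <- l | lt x e] = [::].
  by rewrite /= (all_filterP _) //; apply/allP => y /xl xy; apply: contraFN xe; apply: tr.
by apply/eqP; rewrite -(negbK (_ == _)) -has_filter; apply/hasPn => y /xl xy;
  apply: contraFN xe; apply: tr.
Qed.

Lemma greedy_filter_sub F lt l e : transitive lt -> pairwise lt l ->
  greedy F [seq x <- l | lt x e] \subset greedy F l.
Proof. by move=> tr /(pairwise_split e tr) {2}->; apply: greedy_cat. Qed.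

(** The decision on [e] is taken once, at its turn. The right-hand side also makes sense for [e]
    outside the list; [accepted] and [kept] are modelled on it. *)
Lemma mem_greedy F lt l e : transitive lt -> irreflexive lt -> pairwise lt l ->
  e \in l ->
  (e \in greedy F l) = (e |: greedy F [seq x <- l | lt x e] \in F).
Proof.
move=> tr irr + el; case/splitPr: el => l1 l2.
rewrite pairwise_cat /= allrel_consr => /and4P[/andP[/allP l1e _] _ /allP el2 _].
have nl (x : N) (m : seq N) : {in m, forall y, lt x y || lt y x} -> x \notin m.
  by move=> h; apply/negP => /h; rewrite irr.
have -> : [seq x <- l1 ++ e :: l2 | lt x e] = l1.
  rewrite filter_cat /= irr (all_filterP _); last exact/allP.
  suff -> : [seq x <- l2 | lt x e] = [::] by rewrite cats0.
  apply/eqP; rewrite -(negbK (_ == _)) -has_filter; apply/hasPn => y /el2 ey.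
  by apply/negP => /(tr _ _ _ ey); rewrite irr.
rewrite -cat_rcons greedy_catl; last by apply: nl => y /el2 ->.
rewrite greedy_rcons; case: ifP => _; first by rewrite setU11.
apply/negbTE/negP => /greedy_sub; apply/negP.
by apply: nl => y /l1e ->; rewrite orbT.
Qed.

Lemma card_set_count l (P : pred N) : uniq l ->
  #|[set x in l | P x]| = count P l.
Proof.
move=> ul; rewrite -size_filter -(card_uniqP (filter_uniq P ul)).
by apply: eq_card => x; rewrite !inE mem_filter andbC.
Qed.

Lemma card_greedy F lt l : transitive lt -> irreflexive lt -> pairwise lt l ->
  #|greedy F l| =
  count (fun e => e |: greedy F [seq x <- l | lt x e] \in F) l.
Proof.
move=> tr irr sl; rewrite -card_set_count ?(pairwise_uniq irr) //.
apply: eq_card => e; rewrite !inE; have [el|el] := boolP (e \in l).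
  by rewrite (mem_greedy _ tr irr).
by apply: contraNF el => /greedy_sub.
Qed.

End Greedy.

Section MatroidGreedy.
Variables (N : finType) (M : matroid N).
Implicit Types I J K : {set N}.

Lemma indep_extend I J : I \in indep M -> J \in indep M -> (#|I| <= #|J|)%N ->
  exists2 K : {set N}, K \in indep M &
    [/\ I \subset K, K \subset I :|: J & #|K| = #|J|].
Proof.
have [n] := ubnP (#|J| - #|I|); elim: n I => // n IH I nI iI iJ.
rewrite leq_eqVlt => /orP[/eqP eIJ|ltIJ].
  by exists I => //; split; rewrite ?subsetUl.
have [x] := indep_exchange iI iJ ltIJ; rewrite in_setD => /andP[xI xJ] ixI.
have cxI : #|x |: I| = #|I|.+1 by rewrite cardsU1 xI.
have [||K iK [sK Ks cK]] := IH _ _ ixI iJ; rewrite ?cxI //.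
  by rewrite subnS prednK ?subn_gt0 // -ltnS.
exists K => //; split=> //; first exact: subset_trans (subsetUr _ _) sK.
apply: subset_trans Ks _; rewrite -setUA subUset subxx andbT.
by rewrite sub1set inE xJ orbT.
Qed.

(** The exchange property read backwards; both bounds on numbers of spanned elements reduce to
    it. *)
Lemma leq_card_spanned I J : I \in indep M -> J \in indep M ->
  (forall x, x \in I -> x \notin J -> x |: J \notin indep M) -> (#|I| <= #|J|)%N.
Proof.
move=> iI iJ sp; rewrite leqNgt; apply/negP => /(indep_exchange iJ iI)[x].
by rewrite inE => /andP[xJ xI]; apply/negP/sp.
Qed.

End MatroidGreedy.

(** A total [tie] is reflexive; [x != y] makes the order strict. *)
Definition heavier (R : realType) (N : finType) (tie : rel N) (w : N -> R) : rel N :=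
  fun x y => (w y < w x) || [&& w x == w y, x != y & tie x y].

Section Heavier.
Variables (R : realType) (N : finType) (tie : rel N) (w : N -> R).
Hypothesis tieP : tie_order tie.
Local Notation lt := (heavier tie w).

Lemma heavier_irr : irreflexive lt.
Proof. by move=> x; rewrite /heavier ltxx !eqxx. Qed.

Lemma heavier_trans : transitive lt.
Proof.
case: tieP => tr asym _ y x z /orP[xy|/and3P[/eqP exy nxy txy]] /orP[yz|/and3P[/eqP eyz nyz tyz]].
- by rewrite /heavier (lt_trans yz xy).
- by rewrite /heavier -eyz xy.
- by rewrite /heavier exy yz.
rewrite /heavier exy eyz eqxx (tr _ _ _ txy tyz) /= andbT orbC.
by rewrite (contraNneq _ nxy) // => xz; apply/eqP/asym; rewrite txy xz.
Qed.

Lemma heavier_total x y : x != y -> lt x y || lt y x.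
Proof.
case: tieP => _ _ tot xy; rewrite /heavier (eq_sym (w y)) (eq_sym y) xy /=.
by case: ltgtP => //= _; apply: tot.
Qed.

Lemma heavier_le x y : lt x y -> w y <= w x.
Proof. by case/orP => [/ltW//|/and3P[/eqP->]]. Qed.

Lemma heavier_eq_tie x y : lt x y -> w x = w y -> tie x y.
Proof. by rewrite /heavier => + e; rewrite e ltxx => /and3P[]. Qed.

End Heavier.

(** * The optimum of a matroid as a greedy set *)

Section GreedyOpt.
Variables (R : realType) (N : finType) (tie : rel N) (M : matroid N) (v : N -> R).
Hypotheses (tieP : tie_order tie) (v0 : forall e, 0 <= v e).

Lemma weightU1 (x : N) (I : {set N}) : x \notin I -> weight v (x |: I) = v x + weight v I.
Proof. by move=> xI; rewrite /weight big_setU1. Qed.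

(** By induction, the greedy set agrees with [O] on every prefix. If an element outside [O] could be
    accepted, exchanging it for a later element of [O] would give a set that [O] neither outweighs
    nor beats on ties. Only positive weights are listed because the optimum contains no element of
    weight 0. *)
Lemma greedy_opt (s : seq N) : pairwise (heavier tie v) s ->
  (forall x, (x \in s) = (0 < v x)) -> greedy (indep M) s = opt tie (indep M) v.
Proof.
move=> ps ms; set O := opt _ _ _.
have [_ asym _] := tieP.
have : is_opt tie (indep M) v O.
  by rewrite (opt_unique tieP (indep0 M) (@indepS _ M) v0).
case/andP => /and3P[iO /forall_inP posO /forall_inP maxO] /forallP winO.
suff H l l2 : s = l ++ l2 -> greedy (indep M) l = O :&: [set x in l].
  rewrite (H s [::]) ?cats0 //; apply/setIidPl/subsetP => x /posO.
  by rewrite inE ms.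
elim/last_ind: l l2 => [|l e IH] l2.
  by move=> _; rewrite /greedy /=; apply/setP => x; rewrite !inE andbF.
rewrite cat_rcons => es; rewrite greedy_rcons (IH _ es).
have es2 : e \in s by rewrite es mem_cat inE eqxx orbT.
have -> : [set x in rcons l e] = e |: [set x in l].
  by apply/setP => x; rewrite !inE mem_rcons inE.
have [eO|eO] := boolP (e \in O).
  rewrite (@indepS _ M _ O) //.
    by apply/setP => x; rewrite !inE; case: eqP => // ->; rewrite eO.
  by rewrite subUset sub1set eO subsetIl.
rewrite ifN; last first.
  apply/negP => iel.
  have gtO (K : {set N}) : K \in indep M -> v e + weight v O <= weight v K -> False.
    move=> iK le; have := le_trans le (maxO _ iK).
    by rewrite gerDr leNgt -ms es2.
  (* If the extended set is larger than [O], then [O] lies in the prefix and adding [e], of positive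
     weight, improves it. Otherwise [K] is [O] with some later [f] replaced by [e]. *)
  have [cO|cO] := leqP #|e |: (O :&: [set x in l])| #|O|; last first.
    have OO : O :&: [set x in l] = O.
      apply/eqP; rewrite eqEcard subsetIl /=.
      by move: cO; rewrite cardsU1 inE (negbTE eO) /= add1n ltnS.
    by apply: (gtO _ iel); rewrite OO weightU1.
  have [K iK [sK Ks cK]] := indep_extend iel iO cO.
  have eK : e \in K by apply: subsetP sK _ (setU11 _ _).
  have KO : K :\: O = [set e].
    apply/eqP; rewrite eqEsubset sub1set !inE eO eK !andbT.
    apply/subsetP => x; rewrite !inE => /andP[xO /(subsetP Ks)].
    by rewrite !inE (negbTE xO) orbF /= orbF.
  have : #|O :\: K| = 1%N.
    have := cardsID O K; have := cardsID K O.
    by rewrite KO cards1 cK setIC => <- /eqP; rewrite eqn_add2l => /eqP.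
  move=> /eqP/cards1P[f Of].
  have : f \in O :\: K by rewrite Of inE.
  rewrite inE => /andP[fK fO].
  have fl : f \notin l.
    by apply: contra fK => fl; apply: (subsetP sK); rewrite !inE fO fl orbT.
  have fe : f != e by apply: contraNneq eO => <-.
  have fs : f \in s by rewrite ms posO.
  have ef : heavier tie v e f.
    move: fs ps; rewrite es mem_cat inE (negbTE fl) (negbTE fe) /= => fl2.
    by rewrite pairwise_cat /= => /and4P[_ _ /allP/(_ _ fl2)].
  have wO : weight v O = weight v (O :&: K) + v f.
    by rewrite /weight (big_setID K) /= Of big_set1.
  have wK : weight v K = weight v (O :&: K) + v e.
    by rewrite /weight (big_setID O) /= KO big_set1 setIC.
  have := maxO _ iK; rewrite wO wK lerD2l => vef.
  have vfe : v e = v f by apply/eqP; rewrite eq_le vef (heavier_le ef).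
  have mK : max_weight (indep M) v K.
    apply/and3P; split=> //; last by apply/forall_inP => J /maxO; rewrite wO wK vfe.
    apply/forall_inP => x /(subsetP Ks); rewrite !inE => /orP[/orP[/eqP->|/andP[]]|];
      by rewrite -?ms //= ?ms // => /posO.
  (* [K] has the weight of [O], whose win on ties would require [tie f e], although [e] precedes
     [f]. *)
  have := winO K; rewrite mK /= => /implyP/(_ _).
  have -> : K != O by apply: contraNneq eO => <-.
  case/(_ isT)/exists_inP => f'; rewrite Of inE => /eqP -> /forall_inP/(_ e).
  rewrite KO inE eqxx => /(_ isT) tfe.
  by case/eqP: fe; apply: asym; rewrite tfe (heavier_eq_tie ef).
by apply/setP => x; rewrite !inE; case: eqP => // -> ; rewrite (negbTE eO).
Qed.

End GreedyOpt.

(** * Greedy filtering by a sample *)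

Section SampleGreedy.
Variables (N : finType) (k : nat) (M : 'I_k -> matroid N) (lt : rel N).
Hypotheses (lt_tr : transitive lt) (lt_irr : irreflexive lt).
Implicit Types (l : seq N) (T I J : {set N}).
Local Notation F := (\bigcap_(j < k) indep (M j)).

Lemma mem_commonP I : reflect (forall j, I \in indep (M j)) (I \in F).
Proof. by apply: (iffP bigcapP) => h j //; apply: h. Qed.

Lemma common_set0 : set0 \in F.
Proof. by apply/mem_commonP => j; apply: indep0. Qed.

Lemma common_subset I J : I \subset J -> J \in F -> I \in F.
Proof. by move=> IJ /mem_commonP h; apply/mem_commonP => j; apply: indepS (h j). Qed.

(** Written as a test at the turn of [e], so that it applies to [e] inside and outside [T] alike. *)
Definition accepted l T e : bool :=
  e |: greedy F [seq x <- l | lt x e & x \in T] \in F.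

Definition passing l T e := (e \notin T) && accepted l T e.

(** The greedy set is a basis of the passing elements before [e]: the test says that they do not
    span [e] in [M j]. *)
Definition kept j l T e : bool :=
  e |: greedy (indep (M j)) [seq x <- l | lt x e & passing l T x]
    \in indep (M j).

(** Counts will be compared on every prefix of the sorted list, while the tests refer to the whole
    list; they only look at elements before [e]. *)
Lemma filter_prefix l1 l2 (P : pred N) e : pairwise lt (l1 ++ l2) -> e \in l1 ->
  [seq x <- l1 ++ l2 | lt x e & P x] = [seq x <- l1 | lt x e & P x].
Proof.
rewrite pairwise_cat => /and3P[/allrelP h _ _] el; rewrite filter_cat.
suff -> : [seq x <- l2 | lt x e & P x] = [::] by rewrite cats0.
apply/eqP; rewrite -(negbK (_ == _)) -has_filter; apply/hasPn => y /(h _ _ el) ey.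
by apply/negP => /andP[/(lt_tr ey)]; rewrite lt_irr.
Qed.

Lemma accepted_prefix l1 l2 T e : pairwise lt (l1 ++ l2) -> e \in l1 ->
  accepted (l1 ++ l2) T e = accepted l1 T e.
Proof. by move=> sl el; rewrite /accepted filter_prefix. Qed.

Lemma kept_prefix j l1 l2 T e : pairwise lt (l1 ++ l2) -> e \in l1 ->
  kept j (l1 ++ l2) T e = kept j l1 T e.
Proof.
move=> sl el; rewrite /kept filter_prefix //.
suff -> : [seq x <- l1 | lt x e & passing (l1 ++ l2) T x] =
          [seq x <- l1 | lt x e & passing l1 T x] by [].
by apply: eq_in_filter => x xl; rewrite /passing accepted_prefix.
Qed.

Lemma accepted_setU1 l T e x :
  ~~ lt e x -> accepted l (e |: T) x = accepted l T x.
Proof.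
move=> ex; rewrite /accepted.
suff -> : [seq y <- l | lt y x & y \in e |: T] = [seq y <- l | lt y x & y \in T] by [].
apply: eq_filter => y; rewrite in_setU1; case: eqP => // ->.
by rewrite (negbTE ex).
Qed.

(** The test only reads membership in [T] of elements before [e]. With [accepted_setU1] at [x = e],
    this makes both tests independent of the event that [e] is in [T]. *)
Lemma kept_setU1 j l T e : kept j l (e |: T) e = kept j l T e.
Proof.
rewrite /kept.
suff -> : [seq x <- l | lt x e & passing l (e |: T) x] =
          [seq x <- l | lt x e & passing l T x] by [].
apply: eq_filter => x; case xe: (lt x e) => //=.
have nex : ~~ lt e x by apply/negP => /(lt_tr xe); rewrite lt_irr.
rewrite /passing accepted_setU1 // in_setU1.
by case: eqP xe => // ->; rewrite lt_irr.
Qed.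

Lemma mem_greedy_filter (H : {set {set N}}) l (P : pred N) e :
  pairwise lt l -> e \in l -> P e ->
  (e \in greedy H [seq x <- l | P x]) =
  (e |: greedy H [seq x <- l | lt x e & P x] \in H).
Proof.
move=> sl el Pe; rewrite (mem_greedy _ lt_tr) ?pairwise_filter //.
  by rewrite -filter_predI.
by rewrite mem_filter Pe.
Qed.

Lemma card_greedy_filter (H : {set {set N}}) l (P : pred N) : pairwise lt l ->
  #|greedy H [seq x <- l | P x]| =
  count (fun e => P e && (e |: greedy H [seq x <- l | lt x e & P x] \in H)) l.
Proof.
move=> sl; rewrite (card_greedy _ lt_tr) ?pairwise_filter // count_filter.
by apply: eq_count => e /=; rewrite -filter_predI andbC.
Qed.

Lemma greedy_prefix_sub (H : {set {set N}}) l (P : pred N) e : pairwise lt l ->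
  greedy H [seq x <- l | lt x e & P x] \subset greedy H [seq x <- l | P x].
Proof.
by move=> sl; rewrite filter_predI greedy_filter_sub ?pairwise_filter.
Qed.

(* Every sampled element of [O] outside the greedy set is spanned by it in some
   matroid. *)
Lemma count_feasible l T (O : {set N}) : (0 < k)%N -> pairwise lt l -> O \in F ->
  (count (fun e => (e \in O) && (e \in T)) l <=
   k * count (fun e => (e \in T) && accepted l T e) l)%N.
Proof.
move=> k0 sl OF; have ul := pairwise_uniq lt_irr sl.
rewrite -(card_greedy_filter F (mem T)) //; set J := greedy _ _.
have JF : J \in F by apply/greedy_in/common_set0.
rewrite -card_set_count //; set Q := [set x in l | _].
(* The sampled elements of [O] that are in [J] or spanned by it in [M j]. As part of [O] they are
   independent, hence no more numerous than [J]. *)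
pose Y j := [set x in Q | (x \in J) || (x |: J \notin indep (M j))].
have cY j : (#|Y j| <= #|J|)%N.
  apply: (@leq_card_spanned _ (M j)); first 1 last.
  - exact/mem_commonP.
  - by move=> x; rewrite inE => /andP[_ /orP[->//|]].
  apply: (@indepS _ _ _ O); last exact/mem_commonP.
  by apply/subsetP => x; rewrite !inE => /andP[/andP[_ /andP[]]].
have QY : Q \subset \bigcup_j Y j.
  apply/subsetP => x xQ; have [xJ|xJ] := boolP (x \in J).
    by apply/bigcupP; exists (Ordinal k0) => //; rewrite inE xQ xJ.
  have := xQ; rewrite inE => /and3P[xl xO xT].
  (* A rejected element already conflicts with the greedy set at its turn, hence with the larger
     [J]. *)
  have nF : x |: J \notin F.
    apply: contra xJ => xJF; rewrite mem_greedy_filter //.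
    by apply: common_subset xJF; rewrite setUS // greedy_prefix_sub.
  have [j nj] : exists j, x |: J \notin indep (M j).
    apply/existsP; rewrite -negb_forall; apply: contra nF => /forallP h.
    exact/mem_commonP.
  by apply/bigcupP; exists j => //; rewrite inE xQ nj orbT.
apply: leq_trans (subset_leq_card QY) _.
apply: (@leq_trans (\sum_(j < k) #|Y j|)).
  elim/big_ind2: _ => [|A m B n Am Bn|//]; first by rewrite cards0.
  by apply: leq_trans (leq_add Am Bn); rewrite cardsU leq_subr.
by rewrite -[k in leqRHS]card_ord -sum_nat_const; apply: leq_sum.
Qed.

(* The elements counted on the left are spanned by those counted on the right,
   and independent, being in the greedy feasible subset of [T]. *)
Lemma count_spanned j l T : pairwise lt l ->
  (count (fun e => [&& e \in T, accepted l T e & ~~ kept j l T e]) l <=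
   count (fun e => passing l T e && kept j l T e) l)%N.
Proof.
move=> sl; have ul := pairwise_uniq lt_irr sl.
rewrite -(card_greedy_filter (indep (M j)) (passing l T)) //; set G := greedy _ _.
rewrite -card_set_count //.
apply: (@leq_card_spanned _ (M j)).
- apply: (@indepS _ _ _ (greedy F [seq x <- l | x \in T])); last first.
    exact: (elimT (mem_commonP _) (greedy_in _ common_set0)).
  apply/subsetP => x; rewrite inE => /and4P[xl xT ax _].
  by rewrite mem_greedy_filter.
- exact/greedy_in/indep0.
move=> x; rewrite inE => /and4P[_ _ _ + _]; apply: contra => xG.
by apply: indepS xG; rewrite setUS // greedy_prefix_sub.
Qed.

End SampleGreedy.

(** * From counts on prefixes to weights *)

Lemma abel_sum_lb (R : realFieldType) (N : eqType) (w d : N -> R) (s : seq N) c :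
  (forall x, 0 <= w x) -> {in s, forall x, c <= w x} ->
  pairwise (fun x y => w y <= w x) s ->
  (forall l1 l2, s = l1 ++ l2 -> 0 <= \sum_(x <- l1) d x) ->
  c * \sum_(x <- s) d x <= \sum_(x <- s) w x * d x.
Proof.
move=> w0; elim/last_ind: s c => [|t y IHt] c ct; first by rewrite !big_nil mulr0.
rewrite pairwise_rcons => /andP[/allP yt pt] post.
have yin : c <= w y by apply: ct; rewrite mem_rcons inE eqxx.
have := post _ [::] (esym (cats0 _)); rewrite -!cats1 !big_cat !big_seq1 => h2.
(* Summation by parts: the total of [d] is nonnegative, so [c] may be raised to the last weight
   [w y], which bounds the weights of [t] from below. *)
apply: le_trans (_ : w y * (\sum_(x <- t) d x + d y) <= _).
  exact: ler_wpM2r.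
rewrite mulrDr lerD2r; apply: IHt => // l1 l2 e.
by apply: (post l1 (rcons l2 y)); rewrite e rcons_cat.
Qed.

(** Nonincreasing nonnegative weights are nonnegative combinations of indicators of prefixes, so a
    comparison of counts on all prefixes passes to weights. *)
Lemma ler_sum_count (R : realFieldType) (N : eqType) (w : N -> R) (m : nat)
    (P Q : pred N) (s : seq N) :
  (forall x, 0 <= w x) -> pairwise (fun x y => w y <= w x) s ->
  (forall l1 l2, s = l1 ++ l2 -> (count P l1 <= m * count Q l1)%N) ->
  \sum_(x <- s) w x * (P x)%:R <= m%:R * \sum_(x <- s) w x * (Q x)%:R.
Proof.
move=> w0 ps le; rewrite -subr_ge0 big_distrr -sumrB /=.
have -> : \sum_(x <- s) (m%:R * (w x * (Q x)%:R) - w x * (P x)%:R) =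
    \sum_(x <- s) w x * (m%:R * (Q x)%:R - (P x)%:R).
  by apply: eq_bigr => x _; rewrite mulrBr mulrCA.
apply: le_trans (_ : 0 * \sum_(x <- s) (m%:R * (Q x)%:R - (P x)%:R) <= _).
  by rewrite mul0r.
have cnt (A : pred N) l : \sum_(x <- l) (A x)%:R = (count A l)%:R :> R.
  by elim: l => [|x l IH]; rewrite ?big_nil // big_cons IH -natrD.
apply: abel_sum_lb => // l1 l2 /le; rewrite -(ler_nat R) natrM => h.
by rewrite sumrB -big_distrr /= subr_ge0 !cnt.
Qed.

(** * Independent sampling of the ground set *)

Section Bernoulli.
Variables (R : realFieldType) (N : finType) (p : R).
Implicit Types (T : {set N}) (f : {set N} -> R).

(** The law of a random set containing each element independently with probability [p]. *)
Definition bern T : R := p ^+ #|T| * (1 - p) ^+ #|~: T|.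

Lemma sum_bern : \sum_T bern T = 1.
Proof.
rewrite -[RHS](expr1n _ #|N|) -[1 in RHS](subrKC p) -prodr_const bigA_distr.
apply: eq_big => [T|T _]; first by rewrite inE.
rewrite (bigID (mem T)) /= /bern -!prodr_const; congr (_ * _).
  by apply: eq_bigr => x ->.
by apply: eq_big => [x|x]; rewrite inE // => /negbTE->.
Qed.

Lemma bern_setU1 T e : e \notin T -> (1 - p) * bern (e |: T) = p * bern T.
Proof.
move=> eT; rewrite /bern cardsU1 eT (cardsD1 e (~: T)) inE eT !add1n !exprS.
have -> : ~: (e |: T) = (~: T) :\ e by apply/setP => x; rewrite !inE negb_or.
ring.
Qed.

(** Pairing [T] with [e |: T] shows that a function ignoring [e] is independent of the membership of
    [e], whose odds are [p] to [1 - p]. *)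
Lemma bern_swap e f : (forall T, f (e |: T) = f T) ->
  (1 - p) * (\sum_T bern T * ((e \in T)%:R * f T)) =
  p * \sum_T bern T * ((e \notin T)%:R * f T).
Proof.
move=> fe.
have ind (P : pred {set N}) :
    \sum_T bern T * ((P T)%:R * f T) = \sum_(T | P T) bern T * f T.
  rewrite [RHS]big_mkcond; apply: eq_bigr => T _.
  by case: (P T); rewrite /= ?mul1r // mul0r mulr0.
rewrite !ind (reindex_onto (fun T => e |: T) (fun T => T :\ e)) /=; last first.
  by move=> T eT; rewrite setD1K.
rewrite !big_distrr; apply: eq_big => [T|T /andP[_ /eqP eT]] /=.
  rewrite setU11 /=; apply/eqP/idP => [<-|eT]; first by rewrite !inE eqxx.
  by rewrite setU1K.
have eT' : e \notin T by rewrite -eT !inE eqxx.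
by rewrite fe [LHS]mulrA (bern_setU1 eT') -[LHS]mulrA.
Qed.

Lemma bern_mem e : \sum_T bern T * (e \in T)%:R = p.
Proof.
have := @bern_swap e (fun=> 1) (fun=> erefl).
under eq_bigr do rewrite mulr1.
under [X in _ = p * X -> _]eq_bigr do rewrite mulr1.
have -> : \sum_T bern T * (e \notin T)%:R = 1 - \sum_T bern T * (e \in T)%:R.
  transitivity (\sum_T (bern T - bern T * (e \in T)%:R)); last by rewrite sumrB sum_bern.
  apply: eq_bigr => T _.
  by case: (e \in T); rewrite /= ?mulr1 ?mulr0 ?subrr ?subr0.
by move: (\sum_T _) => A h; lra.
Qed.

End Bernoulli.

Lemma expected_kept (R : realFieldType) (N : finType) (k : nat)
    (M : 'I_k -> matroid N) (lt : rel N) (w : N -> R) (s : seq N) (O : {set N}) :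
  transitive lt -> irreflexive lt -> pairwise lt s -> (0 < k)%N ->
  (forall x, 0 <= w x) -> (forall x y, lt x y -> w y <= w x) ->
  O \in \bigcap_(j < k) indep (M j) ->
  \sum_(e <- s) w e * (e \in O)%:R <=
  4 * k%:R ^+ 2 * \sum_T bern (1 - (2 * k%:R)^-1) T *
    \sum_(e <- s) w e *
      (passing M lt s T e && [forall j, kept M lt j s T e])%:R.
Proof.
move=> tr irr ps k0 w0 ltw OF; set p := 1 - _.
have kR : 0 < k%:R :> R by rewrite ltr0n.
have p1 : 0 < 1 - p by rewrite subKr invr_gt0 mulr_gt0.
have p0 : 0 < p.
  rewrite subr_gt0 invf_lt1 ?mulr_gt0 //.
  by apply: (@lt_le_trans _ _ (2 * 1)); rewrite ?ler_pM2l ?ler1n ?mulr1 ?ltr1n.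
have pw : pairwise (fun x y => w y <= w x) s by apply: sub_pairwise ps.
have bern0 T : 0 <= bern p T by rewrite mulr_ge0 ?exprn_ge0 // ltW.
pose E (P : {set N} -> N -> bool) :=
  \sum_T bern p T * \sum_(e <- s) w e * (P T e)%:R.
have EE P : E P = \sum_(e <- s) w e * \sum_T bern p T * (P T e)%:R.
  rewrite /E; under eq_bigr do rewrite big_distrr /=.
  rewrite exchange_big; apply: eq_bigr => e _; rewrite big_distrr.
  by apply: eq_bigr => T _; rewrite mulrCA.
have E_le m P Q : (forall T l1 l2, s = l1 ++ l2 -> pairwise lt l1 ->
      (count (P T) l1 <= m * count (Q T) l1)%N) -> E P <= m%:R * E Q.
  move=> le; rewrite /E big_distrr; apply: ler_sum => T _ /=.
  rewrite mulrCA ler_wpM2l //; apply: ler_sum_count => // l1 l2 es.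
  by move: ps; rewrite es pairwise_cat => /and3P[_ pl _]; apply: le es pl.
have swap (P : {set N} -> N -> bool) : (forall T e, P (e |: T) e = P T e) ->
    (1 - p) * E (fun T e => (e \in T) && P T e) =
    p * E (fun T e => (e \notin T) && P T e).
  move=> Pe; rewrite !EE !big_distrr; apply: eq_bigr => e _ /=.
  rewrite mulrCA [RHS]mulrCA; congr (_ * _).
  have ind (q : pred {set N}) : \sum_T bern p T * (q T && P T e)%:R =
      \sum_T bern p T * ((q T)%:R * (P T e)%:R).
    by apply: eq_bigr => T _; rewrite -natrM mulnb.
  by rewrite !ind; apply: bern_swap => T; rewrite Pe.
pose acc := accepted M lt s; pose kp j := kept M lt j s.
have accU T e : acc (e |: T) e = acc T e by apply: accepted_setU1; rewrite irr.
have kpU j T e : kp j (e |: T) e = kp j T e by apply: kept_setU1.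
(* [A] is the expected passing weight, [B j] the part of it spanned in [M j]. *)
pose A := E (passing M lt s).
pose B j := E (fun T e => (e \notin T) && (acc T e && ~~ kp j T e)).
have EO : E (fun T e => (e \in O) && (e \in T)) =
    p * \sum_(e <- s) w e * (e \in O)%:R.
  rewrite EE big_distrr; apply: eq_bigr => e _ /=; rewrite mulrCA; congr (_ * _).
  rewrite -[X in _ = X * _](bern_mem p e) big_distrl; apply: eq_bigr => T _ /=.
  by rewrite andbC -mulnb natrM mulrA.
(* [swap] trades the greedy subset of [T] for the passing elements; the factor [p] that it costs
   cancels against the probability that an element of [O] is in [T]. *)
have h1 : (1 - p) * \sum_(e <- s) w e * (e \in O)%:R <= k%:R * A.
  rewrite -(ler_pM2l p0) mulrCA -EO (mulrCA p) -(swap acc) // mulrCA ler_pM2l //.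
  apply: E_le => T l1 l2 es pl1.
  have := count_feasible tr irr T k0 pl1 OF.
  congr (_ <= _ * _)%N; apply: eq_in_count => e el.
  by rewrite /acc es accepted_prefix // -es.
have AB j : E (fun T e => passing M lt s T e && kp j T e) = A - B j.
  rewrite /A /B /E -sumrB; apply: eq_bigr => T _; rewrite -mulrBr -sumrB.
  congr (_ * _); apply: eq_bigr => e _; rewrite -mulrBr; congr (_ * _).
  by rewrite /passing /acc /kp; case: (e \notin T); case: accepted; case: kept;
    rewrite ?subrr ?subr0.
(* [swap] moves [B j] into the sample, where [count_spanned] bounds it by the unspanned part
   [A - B j]; the claim follows by solving for [B j]. *)
have h2 j : B j <= (1 - p) * A.
  suff : p * B j <= (1 - p) * (A - B j) by move: (A) (B j) => a b; lra.
  rewrite -(swap (fun T e => acc T e && ~~ kp j T e)); last first.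
    by move=> T e; rewrite accU kpU.
  rewrite -AB ler_pM2l // -[leRHS]mul1r; apply: (E_le 1%N) => T l1 l2 es pl1.
  rewrite mul1n; have := count_spanned M tr irr j T pl1.
  by congr (_ <= _)%N; apply: eq_in_count => e el; rewrite /kp /acc es
    /passing accepted_prefix ?kept_prefix // -es.
(* Union bound over the matroids. *)
have h3 : A - \sum_j B j <= E (fun T e =>
    passing M lt s T e && [forall j, kept M lt j s T e]).
  rewrite /A /B /E exchange_big /= -sumrB; apply: ler_sum => T _.
  rewrite -big_distrr -mulrBr ler_wpM2l //= exchange_big -sumrB; apply: ler_sum => e _.
  rewrite -big_distrr -mulrBr ler_wpM2l //= /passing -/(acc T e).
  case: (e \notin T); last by rewrite big1 ?subr0.
  case: (acc T e) => /=; last by rewrite big1 ?subr0.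
  have [_|] := boolP [forall j, kept M lt j s T e].
    by rewrite gerBl sumr_ge0.
  case/forallPn => j nj; rewrite subr_le0 (bigD1 j) //= /kp nj lerDl.
  by rewrite sumr_ge0.
have h4 : \sum_j B j <= k%:R * ((1 - p) * A).
  apply: le_trans (_ : \sum_(j < k) (1 - p) * A <= _); first exact: ler_sum.
  by rewrite sumr_const card_ord mulr_natl.
(* Since [1 - p] is [1/(2k)], the bound in [h4] is [A/2], and [h1] bounds the weight of [O] by
   [2k^2] times [A]: together they give [4k^2]. *)
have ep : (1 - p) * (2 * k%:R) = 1 by rewrite subKr mulVf // gt_eqF ?mulr_gt0.
move: h1 h3 h4; rewrite -/(E _).
move: (\sum_(e <- s) _) (E _) (\sum_j _) (A) (1 - p) ep => wO EB SB a q ep h1 h3 h4.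
have -> : wO = 2 * k%:R * (q * wO) by rewrite mulrA (mulrC _ q) ep mul1r.
have aEB : a <= 2 * EB.
  have : 2 * (k%:R * (q * a)) = a by rewrite -[RHS]mul1r -[1 in RHS]ep; ring.
  by move: h3 h4; move: (k%:R * _) => t; lra.
apply: (@le_trans _ _ (2 * k%:R * (k%:R * a))).
  by rewrite ler_pM2l ?mulr_gt0.
have -> : 4 * k%:R ^+ 2 * EB = 2 * k%:R * (k%:R * (2 * EB)) by ring.
by rewrite !ler_pM2l ?mulr_gt0.
Qed.

(** * Weights filtered by a sample *)

Section FilteredWeight.
Variables (R : realType) (N : finType) (tie : rel N) (k : nat).
Variable (M : 'I_k -> matroid N).
Hypothesis tieP : tie_order tie.
Implicit Types (w : N -> R) (T : {set N}).

(** Sorting needs a total relation, hence the reflexive closure of [heavier]. *)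
Definition by_weight w T : seq N :=
  sort (fun x y => (x == y) || heavier tie w x y) [seq x <- enum T | 0 < w x].

Lemma mem_by_weight w T x : (x \in by_weight w T) = (0 < w x) && (x \in T).
Proof. by rewrite mem_sort mem_filter mem_enum. Qed.

Lemma pairwise_by_weight w T : pairwise (heavier tie w) (by_weight w T).
Proof.
set le := fun x y => (x == y) || heavier tie w x y.
have tot : total le.
  move=> x y; rewrite /le [y == x]eq_sym; case: eqP => //= /eqP.
  exact: heavier_total.
have tr : transitive le.
  move=> y x z /orP[/eqP->//|xy] /orP[/eqP<-|yz]; first by rewrite /le xy orbT.
  by rewrite /le (heavier_trans tieP xy yz) orbT.
have := sort_sorted tot [seq x <- enum T | 0 < w x].
rewrite sorted_pairwise // => p.
have : uniq (by_weight w T) by rewrite sort_uniq filter_uniq ?enum_uniq.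
rewrite uniq_pairwise => u.
have : pairwise [rel x y | (x != y) && le x y] (by_weight w T).
  by rewrite pairwise_relI u.
by apply: sub_pairwise => x y /= /andP[/negbTE xy]; rewrite /le xy.
Qed.

Lemma sorted_by_weight w T : sorted (heavier tie w) (by_weight w T).
Proof. exact/pairwise_sorted/pairwise_by_weight. Qed.

(* [by_weight w T] rather than [by_weight w setT]: only the weights of [T] and of
   [e] are known when [e] arrives. *)
Definition passes w T e : bool :=
  (0 < w e) && passing M (heavier tie w) (by_weight w T) T e.

Definition filtered w T e : R := if passes w T e then w e else 0.

Lemma filtered_ge0 w T e : 0 <= filtered w T e.
Proof. by rewrite /filtered /passes; case: ltrP => //= /ltW w0; case: ifP. Qed.

(** This makes the filtered weight of [e] computable on its arrival, when only part of [w] is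
    known. *)
Lemma filtered_local w w' T e : {in T, w =1 w'} -> w e = w' e ->
  filtered w T e = filtered w' T e.
Proof.
move=> ww' we; rewrite /filtered /passes we /passing /accepted.
suff -> : [seq x <- by_weight w T | heavier tie w x e & x \in T] =
          [seq x <- by_weight w' T | heavier tie w' x e & x \in T] by [].
have lt_tr := @heavier_trans R N tie w tieP.
apply: (irr_sorted_eq lt_tr (heavier_irr tie w)).
- exact/sorted_filter/sorted_by_weight.
- apply: pairwise_sorted.
  have := pairwise_filter (fun x => heavier tie w' x e && (x \in T)) (pairwise_by_weight w' T).
  rewrite (@eq_in_pairwise _ (mem T) _ (heavier tie w)) //.
    by move=> x y xT yT; rewrite /heavier !ww'.
  by apply/allP => x; rewrite mem_filter => /andP[/andP[]].
move=> x; rewrite !mem_filter !mem_by_weight.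
by case xT: (x \in T); rewrite ?andbF // /heavier we ww'.
Qed.

Local Notation s w := (by_weight w setT).

Lemma passesE w T e : passes w T e =
  (0 < w e) && passing M (heavier tie w) (s w) T e.
Proof.
rewrite /passes /passing /accepted.
suff -> : [seq x <- by_weight w T | heavier tie w x e & x \in T] =
          [seq x <- s w | heavier tie w x e & x \in T] by [].
have lt_tr := @heavier_trans R N tie w tieP.
apply: (irr_sorted_eq lt_tr (heavier_irr tie w)).
- exact/sorted_filter/sorted_by_weight.
- exact/sorted_filter/sorted_by_weight.
move=> x; rewrite !mem_filter !mem_by_weight inE.
by case: (x \in T); rewrite ?andbF.
Qed.

(** Filtering leaves the order of the passing elements unchanged and makes all other weights 0, so
    [greedy_opt] applies to the filtered list. *)
Lemma opt_filtered w T j : opt tie (indep (M j)) (filtered w T) =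
  greedy (indep (M j)) [seq x <- s w | passing M (heavier tie w) (s w) T x].
Proof.
rewrite -(@greedy_opt _ _ tie _ (filtered w T) tieP (filtered_ge0 w T)
  [seq x <- s w | passing M (heavier tie w) (s w) T x]) //.
  have := pairwise_filter (passing M (heavier tie w) (s w) T) (pairwise_by_weight w setT).
  rewrite (@eq_in_pairwise _ (passes w T) _ (heavier tie (filtered w T))) //.
    by move=> x y; rewrite -!topredE /= => xp yp; rewrite /heavier /filtered xp yp.
  apply/allP => x; rewrite mem_filter mem_by_weight -topredE /= passesE.
  by case/and3P => -> ->.
move=> x; rewrite mem_filter mem_by_weight inE andbT andbC -passesE /filtered.
by rewrite passesE; case: ltP => //= w0; case: ifP; rewrite ?w0 ?ltxx.
Qed.

Lemma expected_opt_filtered w (O : {set N}) : (0 < k)%N -> (forall x, 0 <= w x) ->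
  O \in \bigcap_(j < k) indep (M j) ->
  weight w O / (4 * k%:R ^+ 2) <= \sum_T bern (1 - (2 * k%:R)^-1) T *
    weight w (\bigcap_(j < k) opt tie (indep (M j)) (filtered w T)).
Proof.
move=> k0 w0 OF; have kR : 0 < k%:R :> R by rewrite ltr0n.
rewrite ler_pdivrMr ?mulr_gt0 ?exprn_gt0 // mulrC.
have lt_tr := heavier_trans (w := w) tieP; have lt_irr := heavier_irr tie w.
have us : uniq (s w).
  exact: pairwise_uniq (heavier_irr _ _) (pairwise_by_weight _ _).
have wE (P : {set N}) : weight w P = \sum_(e <- s w) w e * (e \in P)%:R.
  rewrite /weight big_mkcond (big_uniq _ us) [RHS]big_mkcond /=.
  apply: eq_bigr => e _; rewrite mem_by_weight inE andbT.
  case: ltrP => we; first by case: (e \in P); rewrite ?mulr1 ?mulr0.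
  by case: ifP => // _; apply/eqP; rewrite eq_le we w0.
rewrite wE; apply: le_trans (expected_kept (heavier_trans tieP)
  (heavier_irr tie w) (pairwise_by_weight w setT) k0 w0 _ OF) _.
  exact: heavier_le.
apply: ler_wpM2l; first by rewrite mulr_ge0 ?exprn_ge0.
rewrite le_eqVlt; apply/orP; left; apply/eqP; apply: eq_bigr => T _.
congr (_ * _); rewrite wE big_seq [RHS]big_seq; apply: eq_bigr => e es.
congr (_ * (nat_of_bool _)%:R).
apply/andP/bigcapP => [[pe /forallP ke] j _|h].
  rewrite opt_filtered (mem_greedy_filter lt_tr lt_irr) ?pairwise_by_weight //.
  exact: ke.
(* Passing is read off from the optimum of one matroid, available because [k] is positive. *)
have pe : passing M (heavier tie w) (s w) T e.
  by have := h (Ordinal k0) isT; rewrite opt_filtered => /greedy_sub; rewrite mem_filter => /andP[].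
split=> //; apply/forallP => j; have := h j isT.
rewrite opt_filtered (mem_greedy_filter lt_tr lt_irr) ?pairwise_by_weight //.
Qed.

End FilteredWeight.

(** * Uniform samples as unions of independent samples *)

Section UniformSamples.
Variables (R : realFieldType) (N : finType).
Implicit Types (S A B : {set N}) (u : {set N} -> R).

(** For a probability law: uniform conditionally on the size. *)
Definition card_invariant u := forall A B, #|A| = #|B| -> u A = u B.

(** Transposing an element of [A :\: B] with one of [B :\: A] shrinks the difference. *)
Lemma card_invariant_tperm u :
  (forall x y A, u (tperm x y @^-1: A) = u A) -> card_invariant u.
Proof.
move=> inv A B; have [n] := ubnP #|A :\: B|; elim: n A => // n IH A nA cAB.
have [AB|/set0Pn[x xAB]] := eqVneq (A :\: B) set0.
  by congr u; apply/eqP; rewrite eqEcard -setD_eq0 AB eqxx cAB leqnn.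
have [BA|/set0Pn[y yBA]] := eqVneq (B :\: A) set0.
  by congr u; apply/eqP; rewrite eq_sym eqEcard -setD_eq0 BA eqxx cAB leqnn.
rewrite -(inv x y A); apply: IH; last by rewrite card_preimset //; exact: perm_inj.
rewrite -ltnS; apply: leq_trans nA; rewrite ltnS; apply: proper_card; apply/properP.
move: xAB yBA; rewrite !inE => /andP[xB xA] /andP[yA yB]; split.
  apply/subsetP => z; rewrite !inE => /andP[zB].
  case: tpermP => [->|zy|_ _ ->]; rewrite ?(negbTE yA) ?zB //.
  by rewrite zy yB in zB.
by exists x; rewrite !inE ?xA ?xB // tpermL (negbTE yA).
Qed.

Lemma sum_by_card u :
  \sum_(m < #|N|.+1) \sum_(S : {set N} | #|S| == m) u S = \sum_S u S.
Proof.
rewrite [RHS](partition_big (fun S : {set N} => inord #|S| : 'I_(#|N|.+1)) predT) //=.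
apply: eq_bigr => m _; apply: eq_bigl => S /=.
by rewrite -val_eqE /= inordK // ltnS max_card.
Qed.

Lemma sum_card_draws (m : nat) (c : R) :
  \sum_(S : {set N} | #|S| == m) c = c * 'C(#|N|, m)%:R.
Proof.
by rewrite sumr_const -card_draws cardsE mulr_natr.
Qed.

Lemma bin_neq0 S : 'C(#|N|, #|S|)%:R != 0 :> R.
Proof. by rewrite pnatr_eq0 -lt0n bin_gt0 max_card. Qed.

(** An invariant law is recovered from its size law in the form required by [sample_law]. *)
Lemma card_invariant_size u S : card_invariant u ->
  (\sum_(A : {set N} | #|A| == #|S|) u A) / 'C(#|N|, #|S|)%:R = u S.
Proof.
move=> inv; under eq_bigr => A /eqP cA do rewrite (inv A S cA).
by rewrite sum_card_draws mulfK ?bin_neq0.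
Qed.

Lemma sum_size_law (law : nat -> R) : \sum_(m < #|N|.+1) law m = 1 ->
  \sum_(S : {set N}) law #|S| / 'C(#|N|, #|S|)%:R = 1.
Proof.
move=> law1; rewrite -[RHS]law1 -sum_by_card; apply: eq_bigr => m _.
rewrite (eq_bigr (fun=> law m / 'C(#|N|, m)%:R)) => [|S /eqP->//].
by rewrite sum_card_draws divfK // pnatr_eq0 -lt0n bin_gt0 -ltnS.
Qed.

End UniformSamples.

Section JointSample.
Variables (R : realFieldType) (N : finType) (k : nat).
Variables (q0 : {set N} -> R) (q : 'I_k -> {set N} -> R).
Hypotheses (q0_ge0 : forall S, 0 <= q0 S) (q_ge0 : forall j S, 0 <= q j S).
Hypotheses (q0_sum : \sum_S q0 S = 1) (q_sum : forall j, \sum_S q j S = 1).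
Hypotheses (q0_inv : card_invariant q0) (q_inv : forall j, card_invariant (q j)).

Definition joint_sample := ({set N} * {ffun 'I_k -> {set N}})%type.
Implicit Types z : joint_sample.

Definition joint_union z : {set N} := z.1 :|: \bigcup_j z.2 j.

Definition joint_law z : R := q0 z.1 * \prod_j q j (z.2 j).

Definition union_law (S : {set N}) : R := \sum_(z | joint_union z == S) joint_law z.

(* Arbitrary when the conditioning event is negligible. *)
Definition conditional_law (S : {set N}) z : R :=
  if union_law S == 0 then (z == (set0, [ffun=> set0]))%:R
  else (joint_union z == S)%:R * joint_law z / union_law S.

Lemma joint_law_ge0 z : 0 <= joint_law z.
Proof. by rewrite mulr_ge0 // prodr_ge0. Qed.

Lemma union_law_ge0 S : 0 <= union_law S.
Proof. by apply: sumr_ge0 => z _; apply: joint_law_ge0. Qed.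

(** Independence of the samples: distributing the product over the sums gives all families of
    samples. The factors may depend on the first sample. *)
Lemma sum_joint_law (f : {set N} -> R) (g : 'I_k -> {set N} -> {set N} -> R) :
  \sum_z joint_law z * (f z.1 * \prod_j g j z.1 (z.2 j)) =
  \sum_T q0 T * (f T * \prod_j \sum_S q j S * g j T S).
Proof.
rewrite -(pair_bigA _ (fun T (h : {ffun 'I_k -> {set N}}) => q0 T *
  (\prod_j q j (h j)) * (f T * \prod_j g j T (h j)))) /=.
apply: eq_bigr => T _; rewrite bigA_distr_bigA !big_distrr /=.
by apply: eq_bigr => h _; rewrite big_split /=; ring.
Qed.

Lemma sum_union_law : \sum_S union_law S = 1.
Proof.
transitivity (\sum_z joint_law z); first by rewrite (partition_big joint_union predT).
have -> : \sum_z joint_law z = \sum_z joint_law z * (1 * \prod_(j < k) 1).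
  by apply: eq_bigr => z _; rewrite big1 // !mulr1.
rewrite (sum_joint_law (fun=> 1) (fun _ _ _ => 1)) -[RHS]q0_sum; apply: eq_bigr => T _.
rewrite mul1r big1 ?mulr1 // => j _; rewrite -[RHS](q_sum j).
by apply: eq_bigr => S _; rewrite mulr1.
Qed.

(** A transposition applied to all the samples at once preserves the joint law and commutes with the
    union. *)
Lemma union_law_inv : card_invariant union_law.
Proof.
apply: card_invariant_tperm => x y A; set t := tperm x y.
pose h z : joint_sample := (t @^-1: z.1, [ffun j => t @^-1: z.2 j]).
have tK (B : {set N}) : t @^-1: (t @^-1: B) = B.
  by apply/setP => a; rewrite !inE tpermK.
have hK : cancel h h.
  case=> T f; rewrite /h /= tK; congr (_, _); apply/ffunP => j; by rewrite !ffunE tK.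
have hU z : joint_union (h z) = t @^-1: joint_union z.
  apply/setP => a; rewrite !inE; congr (_ || _).
  by apply/bigcupP/bigcupP => -[j _]; rewrite /= ?ffunE ?inE => aj;
    exists j => //; rewrite ?ffunE ?inE.
rewrite /union_law [RHS](reindex_inj (can_inj hK)); apply: eq_big => [z|z _].
  by rewrite hU; apply/eqP/eqP => [->|<-]; rewrite tK.
rewrite /joint_law /h /=; congr (_ * _).
  by apply: q0_inv; rewrite card_preimset //; apply: perm_inj.
apply: eq_bigr => j _; apply: q_inv; rewrite ffunE card_preimset //; exact: perm_inj.
Qed.

Lemma conditional_law_ge0 S z : 0 <= conditional_law S z.
Proof.
rewrite /conditional_law; case: ifP => // _.
by rewrite divr_ge0 ?union_law_ge0 // mulr_ge0 // joint_law_ge0.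
Qed.

Lemma sum_conditional_law S : \sum_z conditional_law S z = 1.
Proof.
rewrite /conditional_law; have [_|u0] := eqVneq.
  by rewrite (bigD1 (set0, [ffun=> set0])) //= eqxx big1 ?addr0 // => z /negbTE->.
rewrite -mulr_suml; apply: (canLR (mulfK u0)); rewrite mul1r.
rewrite /union_law [RHS]big_mkcond; apply: eq_bigr => z _.
by case: ifP; rewrite /= ?mul1r ?mul0r.
Qed.

(** In product form this also covers a negligible [S]: all joint samples with that union then have
    law 0. *)
Lemma union_conditional_law S z :
  union_law S * conditional_law S z = (joint_union z == S)%:R * joint_law z.
Proof.
rewrite /conditional_law; have [u0|u0] := eqVneq.
  rewrite u0 mul0r; case: eqP => [zS|]; last by rewrite mul0r.
  move: u0 => /eqP; rewrite psumr_eq0; last by move=> ? _; apply: joint_law_ge0.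
  by move/allP/(_ z); rewrite mem_index_enum zS eqxx => /(_ isT)/eqP->; rewrite mulr0.
by rewrite mulrC divfK.
Qed.

End JointSample.

From mathcomp Require Import all_classical all_reals all_analysis.
From mathcomp Require Import measurable_realfun.

(** * Random bits and the combined algorithm *)

Local Open Scope classical_set_scope.

Record prob_space (R : realType) := ProbSpace {
  ps_display : measure_display;
  ps_type :> measurableType ps_display;
  ps_law : probability ps_type R
}.

(** Iterated binary products, presented through coordinate maps since the factors have different
    types. *)
Lemma product_space (R : realType) (I : choiceType) (P : I -> prob_space R) (s : seq I) :
  uniq s -> exists (Q : prob_space R) (X : forall i, Q -> P i),
  (forall i (E : set (P i)), measurable E -> measurable (X i @^-1` E)) /\
  (forall E : forall i, set (P i), (forall i, measurable (E i)) ->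
    ps_law Q [set r | forall i, i \in s -> E i (X i r)] =
    (\prod_(i <- s) fine (ps_law (P i) (E i)))%:E).
Proof.
elim: s => [_|i s IH /= /andP[nis us]].
  exists (@ProbSpace R _ unit (dirac tt)), (fun i _ => point); split.
    by move=> i E mE; rewrite -[_ @^-1` _]setTI; apply: measurable_cst.
  move=> E mE; rewrite big_nil (_ : [set _ | _] = setT) ?probability_setT //.
  by apply/seteqP; split.
have [Q [X [mX QX]]] := IH us.
pose Q' := @ProbSpace R _ (ps_type Q * ps_type (P i))%type
  (ps_law Q \x ps_law (P i))%E.
(* The new coordinate has type [P i] and is cast to [P j] along [i = j]. *)
pose X' j (r : Q') : P j := if i =P j is ReflectT e then ecast j (P j) e r.2 else X j r.1.
have X'i r : X' i r = r.2.
  by rewrite /X'; case: eqP => // e; rewrite (eq_axiomK e).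
have X's j r : i != j -> X' j r = X j r.1 by rewrite /X'; case: eqP.
exists Q', X'; split.
  move=> j E mE; have [ij|ij] := eqVneq i j.
    subst j; rewrite (_ : _ @^-1` _ = snd @^-1` E).
      by rewrite -[_ @^-1` _]setTI; apply: measurable_snd.
    by apply/seteqP; split => r /=; rewrite X'i.
  rewrite (_ : _ @^-1` _ = fst @^-1` (X j @^-1` E)).
    by rewrite -[_ @^-1` _]setTI; apply: measurable_fst => //; apply: mX.
  by apply/seteqP; split => r /=; rewrite X's.
move=> E mE.
rewrite (_ : [set _ | _] = [set r | forall j, j \in s -> E j (X j r)] `*` E i); last first.
  apply/seteqP; split => r /=.
    move=> h; split; last by rewrite -X'i; apply: h; rewrite mem_head.
    move=> j js /=; rewrite -X's; first by apply: h; rewrite inE js orbT.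
    by apply: contraNneq nis => ->.
  case=> h1 h2 j; rewrite inE => /predU1P[->|js]; first by rewrite X'i.
  by rewrite X's; [apply: h1|apply: contraNneq nis => ->].
have mE1 : measurable [set r | forall j, j \in s -> E j (X j r)].
  rewrite (_ : [set _ | _] = \big[setI/setT]_(j <- s) (X j @^-1` E j)).
    by apply: bigsetI_measurable => j _; apply: mX.
  by rewrite -bigcap_seq; apply/seteqP; split => r h j; apply: h.
rewrite /= product_measure1E //= QX // big_cons mulrC EFinM fineK //.
exact: fin_num_measure.
Qed.

(** A weighted sum of Dirac masses, carried by [nat], where the outcomes are coded by their
    ranks. *)
Lemma finite_law (R : realType) (Z : finType) (p : Z -> R) :
  (forall z, 0 <= p z) -> \sum_z p z = 1 ->
  exists P : probability nat R, forall z : Z, P [set (enum_rank z : nat)] = (p z)%:E.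
Proof.
move=> p0 p1.
(* An empty sum would not be [1]; [z0] only serves as a default for [nth]. *)
have [z0 _] : exists z0 : Z, True.
  case: (pickP (@predT Z)) => [z _|no]; first by exists z.
  by move: p1; rewrite big_pred0 // => /eqP; rewrite eq_sym oner_eq0.
pose f i := p (nth z0 (enum Z) i).
have f0 i : 0 <= f i by apply: p0.
pose mu : {measure set nat -> \bar R} :=
  msum (fun i => mscale (NngNum (f0 i)) (\d_i)) #|Z|.
have muE A : mu A = (\sum_(i < #|Z|) (p (enum_val i))%:E * \d_(i : nat) A)%E.
  by apply: eq_bigr => i _; rewrite (enum_val_nth z0).
have muT : mu setT = 1%E.
  rewrite muE (eq_bigr (fun i => (p (enum_val i))%:E)) => [|i _]; last first.
    by rewrite diracT mule1.
  by rewrite sumEFin -p1 [in RHS](reindex _ (onW_bij _ (enum_val_bij Z))).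
pose isP := Measure_isProbability.Build _ _ _ mu muT.
pose P : probability nat R := HB.pack (Measure.sort mu) isP.
exists P => z; rewrite -[P _]/(mu _) muE (bigD1 (enum_rank z)) //= enum_rankK.
rewrite diracE mem_set // mule1 big1 ?adde0 // => i iz.
by rewrite diracE memNset ?mule0 // => /= /ord_inj/eqP; apply/negP.
Qed.

Section FiniteMeasure.
Context (d : measure_display) (T : measurableType d) (R : realType).
Variables (P : probability T R) (Z : finType).
Implicit Types (B : Z -> set T).

Lemma measurable_exists B : (forall z, measurable (B z)) ->
  measurable [set r | exists z, B z r].
Proof.
move=> mB; rewrite (_ : [set _ | _] = \bigcup_(z in setT) B z).
  by apply: fin_bigcup_measurable => // z _; apply: mB.
by apply/seteqP; split => r [z]; exists z.
Qed.

Lemma measurable_forall B : (forall z, measurable (B z)) ->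
  measurable [set r | forall z, B z r].
Proof.
move=> mB; rewrite (_ : [set _ | _] = \bigcap_(z in setT) B z).
  by apply: fin_bigcap_measurable => // z _; apply: mB.
by apply/seteqP; split => r h z; [move=> _; apply: h | apply: h].
Qed.

Lemma probability_exists B : (forall z, measurable (B z)) ->
  (forall z z' r, B z r -> B z' r -> z = z') ->
  P [set r | exists z, B z r] = (\sum_z fine (P (B z)))%:E.
Proof.
move=> mB dB; rewrite (_ : [set _ | _] = \bigcup_(z in setT) B z); last first.
  by apply/seteqP; split => r [z]; exists z.
rewrite measure_fin_bigcup //; last by move=> z z' _ _ [r [/dB]]; apply.
rewrite (fsbigE (index_enum Z)) ?index_enum_uniq //; last first.
  by move=> z _; rewrite mem_index_enum.
rewrite -sumEFin; apply: eq_big => [z|z _]; first by rewrite in_setT.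
by rewrite fineK ?fin_num_measure.
exact: finite_finset.
Qed.

Lemma expectation_weight (w : Z -> R) (D : T -> {set Z}) :
  (forall e, 0 <= w e) -> (forall e, measurable [set r | e \in D r]) ->
  'E_P[fun r => weight w (D r)]%E =
  (\sum_e w e * fine (P [set r | e \in D r]))%:E.
Proof.
move=> w0 mD; rewrite unlock.
transitivity (\int[P]_r (\sum_e (w e)%:E * (\1_[set r | e \in D r] r)%:E))%E.
  apply: eq_integral => r _; rewrite /weight big_mkcond -sumEFin.
  apply: eq_bigr => e _; rewrite -EFinM indicE /=.
  case: ifPn => h; first by rewrite mem_set // mulr1.
  by rewrite memNset ?mulr0 //=; apply/negP.
rewrite ge0_integral_sum //.
- rewrite -sumEFin; apply: eq_bigr => e _; rewrite ge0_integralZl_EFin //.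
  + by rewrite integral_indic // setIT EFinM fineK // fin_num_measure.
  + by apply/measurable_EFinP; apply: measurable_indic.
- move=> e; apply: measurable_funeM; apply/measurable_EFinP.
  exact: measurable_indic.
- by move=> e r _; rewrite mule_ge0 ?lee_fin.
Qed.

End FiniteMeasure.

Section MinSeq.
Variables (R : realType) (I : eqType) (s : seq I) (F : I -> \bar R).
Local Open Scope ereal_scope.

Lemma mine_ge0_seq : (forall i, 0 <= F i) -> 0 <= \big[Order.min/+oo]_(i <- s) F i.
Proof.
move=> common_set0; elim/big_ind: _ => // x y x0 y0; by rewrite le_min x0.
Qed.

Lemma mine_le_seq i : i \in s -> \big[Order.min/+oo]_(j <- s) F j <= F i.
Proof.
elim: s => //= j t IH; rewrite inE big_cons ge_min => /predU1P[->|/IH->].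
  by rewrite lexx.
by rewrite orbT.
Qed.

End MinSeq.

(** * Selection probability under the worst arrival order *)

Section Guarantee.
Variables (R : realType) (N : finType) (F : {set {set N}}) (A : order_oblivious R F).
Implicit Types (w : N -> R) (S : {set N}) (e : N).

Definition select_event w S (sigma : seq N) e : set (bits A) :=
  [set r | e \in selected (decide A) w S sigma r].

Definition select_prob w S sigma e : R := fine (bits_law A (select_event w S sigma e)).

Definition guarantee w S e : R := fine
  (\big[Order.min/+oo]_(sigma <- permutations (enum (~: S)%SET))
     bits_law A (select_event w S sigma e))%E.

Lemma measurable_select w S sigma e : measurable (select_event w S sigma e).
Proof.
rewrite /select_event; have [es|es] := boolP (e \in sigma).
  under eq_set => r do rewrite inE es /=.
  exact: decide_measurable.
under eq_set => r do rewrite inE (negbTE es) /=.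
rewrite (_ : [set _ | _] = set0) //; by apply/seteqP; split.
Qed.

Lemma select_probK w S sigma e :
  (select_prob w S sigma e)%:E = bits_law A (select_event w S sigma e).
Proof. by rewrite /select_prob fineK // fin_num_measure //; apply: measurable_select. Qed.

(** The minimum is finite because [enum (~: S)] is itself one of the orders. *)
Lemma guaranteeK w S e : (guarantee w S e)%:E =
  (\big[Order.min/+oo]_(sigma <- permutations (enum (~: S)%SET))
     bits_law A (select_event w S sigma e))%E.
Proof.
rewrite /guarantee fineK // ge0_fin_numE; last exact: mine_ge0_seq.
apply: le_lt_trans (mine_le_seq _ _) _.
  by rewrite mem_permutations; apply: perm_refl.
by rewrite -select_probK ltry.
Qed.

Lemma guarantee_ge0 w S e : 0 <= guarantee w S e.
Proof. by rewrite -lee_fin guaranteeK mine_ge0_seq. Qed.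

Lemma guarantee_le w S sigma e : arrival_order S sigma ->
  guarantee w S e <= select_prob w S sigma e.
Proof.
move=> aS; rewrite -lee_fin guaranteeK select_probK.
by apply: (mine_le_seq (fun s => bits_law A (select_event w S s e)));
  rewrite mem_permutations.
Qed.

Lemma guarantee_sample w S e : e \in S -> guarantee w S e = 0.
Proof.
move=> eS; apply/le_anti; rewrite guarantee_ge0 andbT.
apply: le_trans (guarantee_le w (sigma := enum (~: S)%SET) e (perm_refl _)) _.
rewrite -lee_fin select_probK /select_event.
rewrite (_ : [set _ | _] = set0) ?measure0 //.
by apply/seteqP; split => // r /=; rewrite inE mem_enum inE eS.
Qed.

End Guarantee.

Arguments select_event {R N F} A w S sigma e.
Arguments select_prob {R N F} A w S sigma e.
Arguments guarantee {R N F} A w S e.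

Section SampleLaw.
Variables (R : realType) (N : finType) (F : {set {set N}}) (A : order_oblivious R F).

Lemma sample_law_ge0 S : 0 <= sample_law A S.
Proof. by rewrite divr_ge0 // size_law_ge0. Qed.

Lemma sum_sample_law : \sum_S sample_law A S = 1.
Proof. exact/sum_size_law/size_law_sum1. Qed.

Lemma sample_law_inv : card_invariant (sample_law A).
Proof. by move=> S S' cS; rewrite /sample_law cS. Qed.

End SampleLaw.

Lemma bern_ge0 (R : realFieldType) (N : finType) (p : R) (T : {set N}) :
  0 <= p <= 1 -> 0 <= bern p T.
Proof. by move=> /andP[p0 p1]; rewrite mulr_ge0 ?exprn_ge0 ?subr_ge0. Qed.

Lemma bern_inv (R : realFieldType) (N : finType) (p : R) :
  card_invariant (@bern R N p).
Proof.
move=> A B cAB; rewrite /bern cAB; congr (_ * _ ^+ _).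
by rewrite [LHS]cardsCs [RHS]cardsCs !finset.setCK cAB.
Qed.

(** * Simulation of the given algorithms on one sample *)

Section Combine.
Variables (R : realType) (N : finType) (tie : rel N) (k : nat).
Variables (M : 'I_k -> matroid N) (A : forall j, order_oblivious R (indep (M j))).
Hypothesis tieP : tie_order tie.
Variable p : R.
Hypothesis p01 : 0 <= p <= 1.

Local Notation sample := (joint_sample N k).
Local Notation cond_law :=
  (conditional_law (@bern R N p) (fun j => sample_law (A j))).

(** [Xa j] provides the bits of [A j]. The law of the bits may not depend on the sample, so every
    possible [S] gets its own block [Xz S], drawn from the conditional law given that union. *)
Lemma random_bits : exists (Q : prob_space R) (Xa : forall j, Q -> bits (A j))
    (Xz : {set N} -> Q -> nat),
  [/\ forall j E, measurable E -> measurable (Xa j @^-1` E),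
      forall S E, measurable (Xz S @^-1` E) &
      forall S (z : sample) (E : forall j, set (bits (A j))),
        (forall j, measurable (E j)) ->
        ps_law Q [set r | Xz S r = enum_rank z /\ forall j, E j (Xa j r)] =
        (cond_law S z * \prod_j fine (bits_law (A j) (E j)))%:E].
Proof.
have [PZ PZE] : {PZ : {set N} -> probability nat R &
    forall S (z : sample), PZ S [set (enum_rank z : nat)] = (cond_law S z)%:E}.
  apply: (@choice _ _ (fun S (PS : probability nat R) => forall z : sample,
    PS [set (enum_rank z : nat)] = (cond_law S z)%:E)) => S; apply: finite_law.
    by apply: conditional_law_ge0 => [T|j T]; [apply: bern_ge0|apply: sample_law_ge0].
  exact: sum_conditional_law.
pose P (i : 'I_k + {set N}) : prob_space R :=
  match i with inl j => ProbSpace (bits_law (A j)) | inr S' => ProbSpace (PZ S') end.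
have [Q [X [mX QX]]] := product_space P (index_enum_uniq _).
exists Q, (fun j => X (inl j)), (fun S => X (inr S)); split.
- by move=> j E mE; apply: (mX (inl j)).
- by move=> S E; apply: (mX (inr S)).
move=> S z E mE.
(* The blocks of other samples are unconstrained and contribute factors [1]. *)
pose E' (i : 'I_k + {set N}) : set (P i) :=
  match i with
  | inl j => E j
  | inr S' => if S' == S then [set (enum_rank z : nat)] else setT
  end.
have mE' i : measurable (E' i) by case: i => //= S'; case: ifP.
have := QX E' mE'; rewrite big_sumType /= => QE.
transitivity (ps_law Q [set r | forall i, i \in index_enum ('I_k + {set N})%type -> E' i (X i r)]).
  congr (ps_law Q _); apply/seteqP; split => r /=.
    by case=> h1 h2 [j|S'] _ //=; case: eqP => // ->.
  move=> h; split; first by have := h (inr S); rewrite mem_index_enum /= eqxx; apply.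
  by move=> j; apply: (h (inl j)); rewrite mem_index_enum.
rewrite QE; congr (_%:E); rewrite mulrC; congr (_ * _).
rewrite (bigD1 S) //= eqxx PZE big1 /= ?mulr1 // => S' /negbTE ->.
by rewrite probability_setT.
Qed.

(** The default for unrevealed weights is harmless: by [filtered_local], it does not affect the
    filtered weights of revealed elements when [z.1] is in the sample. *)
Definition simulated_weights (o : {ffun N -> option R}) x : R := odflt 0 (o x).

Definition extended_order S (z : sample) j (sigma : seq N) :=
  enum (S :\: z.2 j)%SET ++ sigma.

Definition simulated_info S (z : sample) j past e (o : {ffun N -> option R}) :=
  revealed (filtered tie M (simulated_weights o) z.1)
    (z.2 j :|: [set x in rcons (extended_order S z j past) e])%SET.

Lemma joint_union_sub (z : sample) : (z.1 \subset joint_union z) /\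
  (forall j, z.2 j \subset joint_union z).
Proof.
split; first exact: finset.subsetUl.
by move=> j; apply: fintype.subset_trans (finset.subsetUr _ _); apply: finset.bigcup_sup.
Qed.

Lemma arrival_extended S (z : sample) j sigma : joint_union z = S ->
  arrival_order S sigma -> arrival_order (z.2 j) (extended_order S z j sigma).
Proof.
move=> zS aS; have ms := perm_mem aS; have us := perm_uniq aS.
have sub : z.2 j \subset S by rewrite -zS (joint_union_sub z).2.
apply: uniq_perm; rewrite ?enum_uniq //.
  rewrite cat_uniq enum_uniq us enum_uniq /= andbT.
  apply/hasPn => x; rewrite ms !mem_enum !inE => /negbTE ->.
  by rewrite andbF.
move=> x; rewrite mem_cat ms !mem_enum !inE.
case xj: (x \in z.2 j) => /=; first by rewrite (fintype.subsetP sub).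
by case: (x \in S).
Qed.

(** The information available online suffices to reproduce the run of [A j] on its own sample, the
    filtered weights and the extended order. *)
Lemma selected_extended (w : N -> R) S (z : sample) j sigma e r :
  joint_union z = S -> arrival_order S sigma -> e \in sigma ->
  let past := take (index e sigma) sigma in
  (e \in selected (decide (A j)) (filtered tie M w z.1) (z.2 j)
     (extended_order S z j sigma) r) =
  decide (A j) (z.2 j) (extended_order S z j past) e
    (simulated_info S z j past e
       (revealed w (S :|: [set x in rcons past e])%SET)) r.
Proof.
move=> zS aS es past; have [T_sub S_sub] := joint_union_sub z.
rewrite zS in T_sub S_sub.
have eS : e \notin S by have := perm_mem aS e; rewrite es mem_enum inE.
rewrite inE mem_cat es orbT /=.
have -> : take (index e (extended_order S z j sigma)) (extended_order S z j sigma)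
    = extended_order S z j past.
  rewrite /extended_order index_cat mem_enum !inE (negbTE eS) andbF.
  by rewrite take_cat ltnNge leq_addr /= addKn.
congr (decide _ _ _ _ _ _); apply/ffunP => x; rewrite !ffunE.
case: ifP => // xin; congr Some; apply: filtered_local => //.
  move=> y yT; rewrite /simulated_weights ffunE finset.in_setU.
  by rewrite (fintype.subsetP T_sub).
rewrite /simulated_weights ffunE ifT //.
move: xin; rewrite !inE !mem_rcons !inE mem_cat mem_enum !inE.
case/or4P => [/(fintype.subsetP (S_sub j))->//|->|/andP[_ ->]//|->]; by rewrite ?orbT.
Qed.

Section Rule.
Variables (Q : prob_space R) (Xa : forall j, Q -> bits (A j)) (Xz : {set N} -> Q -> nat).
Hypothesis mXa : forall j E, measurable E -> measurable (Xa j @^-1` E).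
Hypothesis mXz : forall S E, measurable (Xz S @^-1` E).
Hypothesis law_bits : forall S (z : sample) (E : forall j, set (bits (A j))),
  (forall j, measurable (E j)) ->
  ps_law Q [set r | Xz S r = enum_rank z /\ forall j, E j (Xa j r)] =
  (cond_law S z * \prod_j fine (bits_law (A j) (E j)))%:E.

(** At most one [z] has rank [Xz S r]. If there is none, or its union is not [S], nothing is
    selected, so feasibility holds for all bits and not only almost surely. *)
Definition combined_rule : decision_rule R N Q := fun S past e o r =>
  [exists z : sample, [&& Xz S r == enum_rank z, joint_union z == S &
    [forall j, decide (A j) (z.2 j) (extended_order S z j past) e
       (simulated_info S z j past e o) (Xa j r)]]].

Lemma combined_rule_measurable S past e o :
  measurable [set r | combined_rule S past e o r].
Proof.
pose D (z : sample) j : set (bits (A j)) :=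
  [set b | decide (A j) (z.2 j) (extended_order S z j past) e
             (simulated_info S z j past e o) b].
pose B (z : sample) : set Q := if joint_union z == S
  then Xz S @^-1` [set (enum_rank z : nat)] `&` [set r | forall j, D z j (Xa j r)]
  else set0.
rewrite (_ : [set _ | _] = [set r | exists z, B z r]); last first.
  apply/seteqP; split => r /=.
    by move=> /existsP[z /and3P[/eqP zr zS /forallP h]]; exists z; rewrite /B zS.
  move=> [z]; rewrite /B; case: ifP => // zS [zr h].
  by apply/existsP; exists z; rewrite zS zr eqxx; apply/forallP.
apply: measurable_exists => z; rewrite /B; case: ifP => // _.
apply: measurableI; first exact: mXz.
by apply: (measurable_forall (B := fun j => Xa j @^-1` D z j)) => j;
  apply/mXa/decide_measurable.
Qed.

Lemma mem_combined w S sigma e r : arrival_order S sigma -> e \in sigma ->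
  reflect (exists z : sample, [/\ Xz S r = enum_rank z, joint_union z = S &
     forall j, e \in selected (decide (A j)) (filtered tie M w z.1) (z.2 j)
       (extended_order S z j sigma) (Xa j r)])
  (e \in selected combined_rule w S sigma r).
Proof.
move=> aS es; rewrite inE es /=; apply: (iffP existsP) => -[z].
  move=> /and3P[/eqP zr /eqP zS /forallP h]; exists z; split=> // j.
  by rewrite selected_extended.
move=> [zr zS h]; exists z; rewrite zr zS !eqxx; apply/forallP => j.
by rewrite -selected_extended.
Qed.

(** For fixed bits all arrivals use the same [z], so the selected set is contained in the output of
    a single run of each [A j]. *)
Lemma combined_feasible (w : N -> R) S sigma r : (forall e, 0 <= w e) ->
  arrival_order S sigma ->
  selected combined_rule w S sigma r \in (\bigcap_(j < k) indep (M j))%SET.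
Proof.
move=> w0 aS; apply/bigcapP => j _.
have sub e : e \in selected combined_rule w S sigma r -> e \in sigma.
  by rewrite inE => /andP[].
have [[z [zr zS]]|no] := pselect (exists z : sample,
    Xz S r = enum_rank z /\ joint_union z = S).
  apply: (indepS _ (@decide_feasible _ _ _ (A j) (filtered tie M w z.1) _ _
    (Xa j r) (filtered_ge0 _ _ _ _) (arrival_extended j zS aS))).
  apply/fintype.subsetP => e eB.
  have [z' [zr' _]] := mem_combined w r aS (sub _ eB) eB.
  have -> : z' = z by apply/enum_rank_inj/ord_inj; rewrite -zr zr'.
  exact.
suff -> : selected combined_rule w S sigma r = finset.set0 by apply: indep0.
apply/setP => e; rewrite [RHS]inE; apply/negbTE/negP => eB.
have [z [zr zS _]] := mem_combined w r aS (sub _ eB) eB.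
by apply: no; exists z.
Qed.

Local Notation u := (union_law (@bern R N p) (fun j => sample_law (A j))).

Definition union_size_law m : R := \sum_(S : {set N} | #|S| == m) u S.

Lemma union_ge0 S : 0 <= u S.
Proof.
by apply: union_law_ge0 => [T|j T]; [apply: bern_ge0|apply: sample_law_ge0].
Qed.

Lemma union_size_law_ge0 m : 0 <= union_size_law m.
Proof. by apply: sumr_ge0 => S _; apply: union_ge0. Qed.

Lemma union_size_law_sum1 : \sum_(m < #|N|.+1) union_size_law m = 1.
Proof.
rewrite sum_by_card sum_union_law //; first exact: sum_bern.
by move=> j; apply: sum_sample_law.
Qed.

Definition combined : order_oblivious R (\bigcap_(j < k) indep (M j))%SET :=
  @OrderOblivious R N _ _ union_size_law_ge0 union_size_law_sum1 _ _ (ps_law Q) _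
    combined_rule_measurable combined_feasible.

Lemma sample_law_combined S : sample_law combined S = u S.
Proof.
apply: card_invariant_size; apply: union_law_inv; first exact: bern_inv.
by move=> j; apply: sample_law_inv.
Qed.

(** The events for different [z] are disjoint, and for a given [z] the bits of the [A j] are
    independent. *)
Lemma combined_select_prob w S sigma e : arrival_order S sigma -> e \in sigma ->
  select_prob combined w S sigma e =
  \sum_(z : sample) (joint_union z == S)%:R * (cond_law S z *
    \prod_j select_prob (A j) (filtered tie M w z.1) (z.2 j)
      (extended_order S z j sigma) e).
Proof.
move=> aS es; pose Ev (z : sample) j :=
  select_event (A j) (filtered tie M w z.1) (z.2 j) (extended_order S z j sigma) e.
pose B (z : sample) := [set r | joint_union z = S /\
   (Xz S r = enum_rank z /\ forall j, Ev z j (Xa j r))].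
have BE z : B z = if joint_union z == S
    then Xz S @^-1` [set (enum_rank z : nat)] `&` [set r | forall j, (Xa j @^-1` Ev z j) r]
    else set0.
  by rewrite /B; case: eqP => zS; apply/seteqP; split => r //= [].
have mB z : measurable (B z).
  rewrite BE; case: ifP => // _; apply: measurableI; first exact: mXz.
  by apply: measurable_forall => j; apply/mXa/measurable_select.
rewrite /select_prob /select_event /=.
rewrite (_ : [set _ | _] = [set r | exists z, B z r]); last first.
  apply/seteqP; split => r /=.
    by move=> /(mem_combined w r aS es)[z [h1 h2 h3]]; exists z.
  by move=> [z [h1 [h2 h3]]]; apply/(mem_combined w r aS es); exists z.
rewrite probability_exists //=; last first.
  by move=> z z' r [_ [h _]] [_ [h' _]]; apply/enum_rank_inj/ord_inj; rewrite -h h'.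
apply: eq_bigr => z _; have [zS|zS] := eqVneq (joint_union z) S; last first.
  by rewrite BE (negbTE zS) measure0 mul0r.
rewrite mul1r -[RHS]/(fine _%:E) -law_bits.
  by congr (fine (ps_law Q _)); apply/seteqP; split => r // [].
by move=> j; apply: measurable_select.
Qed.

(* The optima of the filtered weights avoid the filtering sample [z.1], and
   an element sampled by some [A j] has guarantee [0]: the product below
   vanishes unless [e] arrives in the second phase. *)
Lemma combined_guarantee w (sigma : {set N} -> seq N) e : (0 < k)%N ->
  (forall S, arrival_order S (sigma S)) ->
  \sum_(z : sample) joint_law (@bern R N p) (fun j => sample_law (A j)) z *
    ((e \in (\bigcap_(j < k) opt tie (indep (M j)) (filtered tie M w z.1))%SET)%:R *
     \prod_j guarantee (A j) (filtered tie M w z.1) (z.2 j) e) <=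
  \sum_S u S * select_prob combined w S (sigma S) e.
Proof.
move=> k0 aS; pose h (z : sample) : R :=
  (e \in (\bigcap_(j < k) opt tie (indep (M j)) (filtered tie M w z.1))%SET)%:R *
  \prod_j guarantee (A j) (filtered tie M w z.1) (z.2 j) e.
have h0 z : 0 <= h z.
  by rewrite mulr_ge0 // prodr_ge0 // => j _; apply: guarantee_ge0.
have cond0 S z : 0 <= cond_law S z.
  by apply: conditional_law_ge0 => [T|j T]; [apply: bern_ge0|apply: sample_law_ge0].
(* An equality: the union law times the conditional law restores the joint law. *)
apply: (@le_trans _ _ (\sum_S u S * \sum_z (joint_union z == S)%:R * (cond_law S z * h z))).
  rewrite le_eqVlt; apply/orP; left; apply/eqP.
  under [RHS]eq_bigr do rewrite big_distrr /=.
  rewrite [RHS]exchange_big; apply: eq_bigr => z _ /=.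
  have uz := @union_conditional_law _ _ _ (@bern R N p) (fun j => sample_law (A j))
    (fun T => @bern_ge0 R N p T p01) (fun j => @sample_law_ge0 _ _ _ (A j)) (joint_union z) z.
  rewrite [RHS](bigD1 (joint_union z)) //= eqxx mul1r [X in _ = X + _]mulrA uz.
  rewrite eqxx mul1r [X in _ = _ + X]big1 ?addr0 // => S; rewrite eq_sym => /negbTE->.
  by rewrite mul0r mulr0.
apply: ler_sum => S _; apply: ler_wpM2l; first exact: union_ge0.
have [es|es] := boolP (e \in sigma S).
  rewrite combined_select_prob //; apply: ler_sum => z _; have [zS|] := eqVneq; last first.
    by rewrite !mul0r.
  rewrite !mul1r; apply: ler_wpM2l; first exact: cond0.
  apply: (@le_trans _ _ (\prod_j guarantee (A j) (filtered tie M w z.1) (z.2 j) e)).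
    rewrite /h; case: (e \in _); rewrite ?mul1r ?mul0r //.
    by apply: prodr_ge0 => j _; apply: guarantee_ge0.
  (* The order shown to [A j] depends on the other samples too; its guarantee holds against every
     order. *)
  apply: ler_prod => j _; rewrite guarantee_ge0 /=.
  exact/guarantee_le/arrival_extended.
have eS : e \in S by apply: contraR es => eS; rewrite (perm_mem (aS S)) mem_enum inE.
rewrite big1; first by rewrite /select_prob fine_ge0.
move=> z _; have [zS|] := eqVneq; last by rewrite mul0r.
suff -> : h z = 0 by rewrite !mulr0.
rewrite /h; case: bigcapP => eopt; last by rewrite mul0r.
have eT : e \notin z.1.
  have := eopt (Ordinal k0) isT; rewrite opt_filtered // => /greedy_sub.
  by rewrite mem_filter => /andP[/andP[]].
move: eS; rewrite -zS inE (negbTE eT) => /bigcupP[j _ ej].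
by rewrite (bigD1 j) //= guarantee_sample // mul0r mulr0.
Qed.

End Rule.
End Combine.

(** * Competitive ratio of the combined algorithm *)

Theorem theorem1 (R : realType) (N : finType) (tie : rel N) (k : nat)
    (M : 'I_k -> matroid N) (c : 'I_k -> R) :
  tie_order tie -> (0 < k)%N -> (forall j, 0 <= c j) ->
  (forall j, exists A : order_oblivious R (indep (M j)),
     opt_competitive tie A (c j)) ->
  exists B : order_oblivious R (\bigcap_(j < k) indep (M j))%SET,
    competitive tie B (1 / (4 * k%:R ^+ 2) * \prod_(j < k) c j).
Proof.
move=> tieP k0 c0 exA.
pose A j := projT1 (cid (exA j)).
have Ac j : opt_competitive tie (A j) (c j) by rewrite /A; case: cid.
set p : R := 1 - (2 * k%:R)^-1.
have kR : 0 < k%:R :> R by rewrite ltr0n.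
have p01 : 0 <= p <= 1.
  have k2 : 1 <= 2 * k%:R :> R by rewrite -natrM ler1n muln_gt0.
  by rewrite subr_ge0 invf_le1 ?(lt_le_trans ltr01) // k2 gerBl invr_ge0 (le_trans ler01).
have [Q [Xa [Xz [mXa mXz law_bits]]]] := random_bits A p01.
exists (combined tieP p01 mXa mXz) => w sigma w0 aS.
set B := combined _ _ _ _.
have BE S : ('E_(bits_law B)[fun r => weight w (selected (decide B) w S (sigma S) r)] =
    (\sum_e w e * select_prob B w S (sigma S) e)%:E)%E.
  by apply: expectation_weight => // e; apply: measurable_select.
rewrite (eq_bigr (fun S => (sample_law B S *
    \sum_e w e * select_prob B w S (sigma S) e)%:E)) => [|S _]; last first.
  by rewrite [RHS]EFinM -BE.
rewrite sumEFin lee_fin.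
set O := opt _ _ _.
have OF : O \in (\bigcap_(j < k) indep (M j))%SET.
  by rewrite /O /opt; case: pickP => [I /andP[/and3P[]]|_]; last exact: common_set0.
have := expected_opt_filtered tieP k0 w0 OF; rewrite -/p => hO.
(* The intermediate quantity is the expected weight of the common filtered optima, discounted by the
   product of the [c j]; the rest is compared element by element. *)
apply: (@le_trans _ _ ((\prod_j c j) * \sum_T bern p T *
    weight w (\bigcap_(j < k) opt tie (indep (M j)) (filtered tie M w T))%SET)).
  rewrite mul1r mulrAC [leLHS]mulrC; apply: ler_wpM2l; first exact: prodr_ge0.
  by rewrite mulrC.
under [leRHS]eq_bigr => S _ do rewrite big_distrr /=.
rewrite [leRHS]exchange_big /=.
apply: (@le_trans _ _ (\sum_e w e * \sum_T bern p T *
    ((e \in (\bigcap_(j < k) opt tie (indep (M j)) (filtered tie M w T))%SET)%:R *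
     \prod_j c j))).
  rewrite le_eqVlt; apply/orP; left; apply/eqP.
  under [RHS]eq_bigr => e _ do rewrite big_distrr /=.
  rewrite [RHS]exchange_big [LHS]big_distrr; apply: eq_bigr => T _ /=.
  rewrite /weight [X in bern p T * X]big_mkcond [X in _ * X = _]big_distrr.
  rewrite [LHS]big_distrr; apply: eq_bigr => e _ /=.
  by case: (e \in _); rewrite /= ?mul1r ?mul0r ?mulr0 //; ring.
apply: ler_sum => e _.
under [leRHS]eq_bigr => S _ do rewrite mulrCA sample_law_combined.
rewrite -big_distrr; apply: ler_wpM2l => //=.
apply: le_trans _ (combined_guarantee tieP p01 mXa mXz law_bits w e k0 aS).
rewrite (sum_joint_law (@bern R N p) (fun j => sample_law (A j))
  (fun T => (e \in (\bigcap_(j < k) opt tie (indep (M j)) (filtered tie M w T))%SET)%:R)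
  (fun j T S => guarantee (A j) (filtered tie M w T) S e)).
apply: ler_sum => T _; apply: ler_wpM2l; first exact: bern_ge0.
case: bigcapP => [eopt|]; last by rewrite !mul0r.
rewrite !mul1r; apply: ler_prod => j _; rewrite c0 /= -lee_fin.
(* Once [T] is fixed, so are the filtered weights, and OPT-competitiveness applies to them because
   the sample of [A j] is independent of [T]. *)
have := Ac j (filtered tie M w T) e (filtered_ge0 _ _ _ _) (eopt j isT).
rewrite -sumEFin; congr (_ <= _)%E; apply: eq_bigr => S _.
by rewrite [RHS]EFinM guaranteeK.
Qed.
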